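(* Let $k$ be an algebraically closed field of characteristic not two and let $R=k[\![x,y,z]\!]/(xy)$. For all integers $0\le a<b$, the ideal $(x,z^a)$ of $R$ degenerates neither to $(x,z^b)$ nor to $(y,z^b)$, and the ideal $(y,z^a)$ of $R$ degenerates neither to $(x,z^b)$ nor to $(y,z^b)$ (as $R$-modules).
   Context: Degeneration: let $R$ be a noetherian algebra over a field $k$ and let $M,N$ be finitely generated $R$-modules. We say that $M$ degenerates to $N$ if there exist a discrete valuation ring $V$ that is a $k$-algebra, with maximal ideal $tV$ and residue field $k$, and a finitely generated $R\otimes_k V$-module $Q$ such that $Q$ is flat as a $V$-module, $Q/tQ\cong N$ as $R$-modules, and $Q_t\cong M\otimes_k V_t$ as $R\otimes_k V_t$-modules (subscript $t$ denotes inverting $t$). Here $z^0=1$. *)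

(* Defs.v *)
From HB Require Import structures.
From mathcomp Require Import all_boot all_algebra.
From mathcomp Require Import boolp zify.

Set Implicit Arguments.
Unset Strict Implicit.
Unset Printing Implicit Defensive.

Import GRing.Theory.

Local Open Scope ring_scope.
Local Open Scope quotient_scope.

(* K-algebras are given by their structure morphisms.  Tensor products and   *)
(* localizations may be trivial rings, whence comPzRingType.                 *)

Definition restrict (K A : pzRingType) (f : {rmorphism K -> A})
  (M : lmodType A) : Type := M.

Section Restrict.
Variables (K A : pzRingType) (f : {rmorphism K -> A}) (M : lmodType A).
Local Notation Mf := (restrict f M).

HB.instance Definition _ := GRing.Zmodule.on Mf.

Let scale (c : K) (m : Mf) : Mf := f c *: (m : M).

Fact restrict_scaleA a b v : scale a (scale b v) = scale (a * b) v.
Proof. by rewrite /scale scalerA rmorphM. Qed.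
Fact restrict_scale1 : left_id 1 scale.
Proof. by move=> v; rewrite /scale rmorph1 scale1r. Qed.
Fact restrict_scaleDr : right_distributive scale +%R.
Proof. by move=> a u v; rewrite /scale scalerDr. Qed.
Fact restrict_scaleDl v : {morph scale^~ v : a b / a + b}.
Proof. by move=> a b; rewrite /scale rmorphD scalerDl. Qed.

HB.instance Definition _ := GRing.Zmodule_isLmodule.Build K Mf
  restrict_scaleA restrict_scale1 restrict_scaleDr restrict_scaleDl.

Lemma restrictZ c (m : M) : c *: (m : Mf) = f c *: m.
Proof. by []. Qed.

End Restrict.

(* M (x)_K N is the commutative monoid generated by the pairs (m, n), modulo *)
(* the bilinearity relations; it is a group, (- m, n) being opposite to      *)
(* (m, n).  The pairs listed in a sequence are added up.                     *)
Section Tensor.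
Variables (K : comPzRingType) (M N : lmodType K).

Inductive tens_eqv : seq (M * N) -> seq (M * N) -> Prop :=
| TensRefl s : tens_eqv s s
| TensSym s t : tens_eqv s t -> tens_eqv t s
| TensTrans s t u : tens_eqv s t -> tens_eqv t u -> tens_eqv s u
| TensCat s1 t1 s2 t2 :
    tens_eqv s1 t1 -> tens_eqv s2 t2 -> tens_eqv (s1 ++ s2) (t1 ++ t2)
| TensCatC s t : tens_eqv (s ++ t) (t ++ s)
| Tens0 n : tens_eqv [:: (0, n)] [::]
| TensDl m m' n : tens_eqv [:: (m + m', n)] [:: (m, n); (m', n)]
| TensDr m n n' : tens_eqv [:: (m, n + n')] [:: (m, n); (m, n')]
| TensZ c m n : tens_eqv [:: (c *: m, n)] [:: (m, c *: n)].

Definition tens_rel : rel (seq (M * N)) := fun s t => `[< tens_eqv s t >].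

Fact tens_rel_equiv : equiv_class_of tens_rel.
Proof.
split=> [s|s t|t s u].
- exact/asboolP/TensRefl.
- by apply/asboolP/asboolP; apply: TensSym.
- by move=> /asboolP st /asboolP tu; apply/asboolP; apply: TensTrans st tu.
Qed.

Canonical tens_rel_equivRel := EquivRelPack tens_rel_equiv.
Canonical tens_rel_encModRel := defaultEncModRel tens_rel.

Definition tensor : Type := {eq_quot tens_rel}.
HB.instance Definition _ := Choice.on tensor.
HB.instance Definition _ := EqQuotient.on tensor.

Lemma pi_tensP s t : reflect (tens_eqv s t) (\pi_tensor s == \pi_tensor t).
Proof. by rewrite piE; apply: asboolP. Qed.

Lemma pi_tens s t : tens_eqv s t -> \pi_tensor s = \pi_tensor t.
Proof. by move=> st; apply/eqP/pi_tensP. Qed.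

Lemma repr_tens s : tens_eqv (repr (\pi_tensor s)) s.
Proof. by apply/pi_tensP; rewrite reprK. Qed.

Definition tens_zero : tensor := \pi_tensor [::].
Definition tens_add (x y : tensor) : tensor := \pi_tensor (repr x ++ repr y).
Definition tens_opp (x : tensor) : tensor := \pi_tensor [seq (- p.1, p.2) | p <- repr x].

Lemma tens_addE s t : tens_add (\pi_tensor s) (\pi_tensor t) = \pi_tensor (s ++ t).
Proof. by apply: pi_tens; apply: TensCat; apply: repr_tens. Qed.

Fact tens_addA : associative tens_add.
Proof.
move=> x y z; rewrite -[x]reprK -[y]reprK -[z]reprK.
move: (repr x) (repr y) (repr z) => s t u.
by rewrite (tens_addE t u) (tens_addE s t) (tens_addE s) (tens_addE _ u) catA.
Qed.
Fact tens_addC : commutative tens_add.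
Proof. by move=> x y; apply/pi_tens/TensCatC. Qed.
Fact tens_add0 : left_id tens_zero tens_add.
Proof. by move=> x; rewrite -[x]reprK tens_addE. Qed.
Fact tens_addN : left_inverse tens_zero tens_opp tens_add.
Proof.
move=> x; rewrite -{2}[x]reprK tens_addE; apply: pi_tens.
elim: (repr x) => [|[m n] s IHs] /=; first exact: TensRefl.
set s' := map _ _ in IHs *.
have h : tens_eqv [:: (- m, n); (m, n)] [::].
  apply: TensTrans (Tens0 n); rewrite -(addNr m); exact/TensSym/TensDl.
apply: (TensTrans (t := [:: (- m, n); (m, n)] ++ (s' ++ s))); last first.
  exact: TensCat h IHs.
rewrite -cat1s -[(m, n) :: s]cat1s -[[:: _; _]]cat1s -!catA.
apply: TensCat; first exact: TensRefl.
by rewrite !catA; apply: TensCat (TensRefl _); apply: TensCatC.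
Qed.

HB.instance Definition _ :=
  GRing.isZmodule.Build tensor tens_addA tens_addC tens_add0 tens_addN.

Definition pure (m : M) (n : N) : tensor := \pi_tensor [:: (m, n)].

Lemma pi_tens_cat s t : \pi_tensor (s ++ t) = \pi_tensor s + \pi_tensor t.
Proof. by rewrite -tens_addE. Qed.

Lemma pi_tens_sum s : \pi_tensor s = \sum_(p <- s) pure p.1 p.2.
Proof.
elim: s => [|[m n] s IHs]; first by rewrite big_nil.
by rewrite big_cons -IHs -cat1s pi_tens_cat.
Qed.

Lemma tens_sum (x : tensor) : x = \sum_(p <- repr x) pure p.1 p.2.
Proof. by rewrite -pi_tens_sum reprK. Qed.

Lemma tens_ind (P : tensor -> Prop) :
  P 0 -> (forall x y, P x -> P y -> P (x + y)) ->
  (forall m n, P (pure m n)) -> forall x, P x.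
Proof.
by move=> P0 PD Pp x; rewrite (tens_sum x); apply: big_ind => // p _.
Qed.

Definition balanced (P : zmodType) (b : M -> N -> P) : Prop :=
  [/\ forall m m' n, b (m + m') n = b m n + b m' n,
      forall m n n', b m (n + n') = b m n + b m n'
    & forall c m n, b (c *: m) n = b m (c *: n)].

Lemma pure_balanced : balanced pure.
Proof.
split=> [m m' n|m n n'|c m n]; last exact/pi_tens/TensZ.
- by rewrite -pi_tens_cat; apply/pi_tens/TensDl.
- by rewrite -pi_tens_cat; apply/pi_tens/TensDr.
Qed.

Section Lift.
Variables (P : zmodType) (b : M -> N -> P).

Definition tens_lift (x : tensor) : P := \sum_(p <- repr x) b p.1 p.2.

Hypothesis bP : balanced b.

Lemma tens_lift_pi s : tens_lift (\pi_tensor s) = \sum_(p <- s) b p.1 p.2.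
Proof.
have [bDl bDr bZ] := bP; rewrite /tens_lift.
move: (repr _) (repr_tens s) => t; elim=> {s t} //.
- by move=> s t u _ -> _ ->.
- by move=> s1 t1 s2 t2 _ e1 _ e2; rewrite !big_cat /= e1 e2.
- by move=> s t; rewrite !big_cat /= addrC.
- move=> n; rewrite big_seq1 big_nil /=.
  by apply: (addrI (b 0 n)); rewrite -bDl !addr0.
- by move=> m m' n; rewrite !big_cons !big_nil /= !addr0.
- by move=> m n n'; rewrite !big_cons !big_nil /= !addr0.
- by move=> c m n; rewrite !big_seq1 /=.
Qed.

Lemma tens_lift_pure m n : tens_lift (pure m n) = b m n.
Proof. by rewrite tens_lift_pi big_seq1. Qed.

Lemma tens_liftD : {morph tens_lift : x y / x + y}.
Proof.
by move=> x y; rewrite -[x]reprK -[y]reprK -pi_tens_cat !tens_lift_pi big_cat.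
Qed.

Lemma tens_lift0 : tens_lift 0 = 0.
Proof. by apply: (addrI (tens_lift 0)); rewrite -tens_liftD !addr0. Qed.

End Lift.

End Tensor.

Arguments pure {K M N}.

Definition tens_map (K : comPzRingType) (A B : lmodType K) (h : A -> B)
    (P : lmodType K) : tensor A P -> tensor B P :=
  tens_lift (fun a p => pure (h a) p).

Definition flat (V : comPzRingType) (P : lmodType V) : Prop :=
  forall (A B : lmodType V) (h : {linear A -> B}),
    injective h -> injective (tens_map h (P := P)).

Definition tens_mod (K A B : comPzRingType) (f : {rmorphism K -> A})
    (g : {rmorphism K -> B}) (M : lmodType A) (N : lmodType B) : Type :=
  tensor (restrict f M) (restrict g N).

HB.instance Definition _ (K A B : comPzRingType) (f : {rmorphism K -> A})
    (g : {rmorphism K -> B}) (M : lmodType A) (N : lmodType B) :=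
  GRing.Zmodule.on (tens_mod f g M N).

Definition tens_alg (K A B : comPzRingType) (f : {rmorphism K -> A})
    (g : {rmorphism K -> B}) : Type :=
  tens_mod f g A^o B^o.

HB.instance Definition _ (K A B : comPzRingType) (f : {rmorphism K -> A})
    (g : {rmorphism K -> B}) := GRing.Zmodule.on (tens_alg f g).

Section TensorAction.
Variables (K A B : comPzRingType).
Variables (f : {rmorphism K -> A}) (g : {rmorphism K -> B}).
Variables (M : lmodType A) (N : lmodType B).

(* (a (x) b) (m (x) n) = (a m) (x) (b n)                                     *)
Definition tens_act1 (a : A) (b : B) : tens_mod f g M N -> tens_mod f g M N :=
  tens_lift (M := restrict f M) (N := restrict g N)
    (fun m n => pure (a *: m : restrict f M) (b *: n : restrict g N)).

Definition tens_act (c : tens_alg f g) (x : tens_mod f g M N) :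
    tens_mod f g M N :=
  tens_lift (M := restrict f A^o) (N := restrict g B^o)
    (fun a b => tens_act1 a b x) c.

Fact tens_act1_balanced a b : balanced
  (fun (m : restrict f M) (n : restrict g N) =>
     pure (a *: (m : M) : restrict f M) (b *: (n : N) : restrict g N)).
Proof.
have [pDl pDr pZ] := pure_balanced (restrict f M) (restrict g N).
split=> [m m' n|m n n'|c m n]; rewrite ?scalerDr ?pDl ?pDr //.
rewrite !restrictZ !scalerA [a * f c]mulrC [b * g c]mulrC.
by rewrite -(scalerA (f c)) -(scalerA (g c)); apply: pZ.
Qed.

Lemma tens_act1_pure a b m n :
  tens_act1 a b (pure (m : restrict f M) (n : restrict g N)) =
  pure (a *: m : restrict f M) (b *: n : restrict g N).
Proof. by rewrite /tens_act1 (tens_lift_pure (tens_act1_balanced a b)). Qed.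

Lemma tens_act1D a b : {morph tens_act1 a b : x y / x + y}.
Proof. exact: (tens_liftD (tens_act1_balanced a b)). Qed.

Lemma tens_act10 a b : tens_act1 a b 0 = 0.
Proof. exact: (tens_lift0 (tens_act1_balanced a b)). Qed.

Fact tens_act_balanced x : balanced
  (fun (a : restrict f A^o) (b : restrict g B^o) => tens_act1 a b x).
Proof.
have [pDl pDr pZ] := pure_balanced (restrict f M) (restrict g N).
split=> [a a' b|a b b'|c a b]; elim/(@tens_ind K): x => [|x y IHx IHy|m n];
  rewrite ?tens_act10 ?tens_act1D ?addr0 //.
- by rewrite IHx IHy addrACA.
- by rewrite !tens_act1_pure scalerDl pDl.
- by rewrite IHx IHy addrACA.
- by rewrite !tens_act1_pure scalerDl pDr.
- by rewrite IHx IHy.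
- by rewrite !tens_act1_pure !restrictZ -[f c *: a]/(f c * a)
    -[g c *: b]/(g c * b) -!scalerA; apply: pZ.
Qed.

Lemma tens_act_pure a b x :
  tens_act (pure (a : restrict f A^o) (b : restrict g B^o)) x = tens_act1 a b x.
Proof. by rewrite /tens_act (tens_lift_pure (tens_act_balanced x)). Qed.

Lemma tens_actDl x : {morph tens_act^~ x : c d / c + d}.
Proof. exact: (tens_liftD (tens_act_balanced x)). Qed.

Lemma tens_act0l x : tens_act 0 x = 0.
Proof. exact: (tens_lift0 (tens_act_balanced x)). Qed.

Lemma tens_actDr : right_distributive tens_act +%R.
Proof.
move=> c x y; elim/(@tens_ind K): c => [|c d IHc IHd|a b].
- by rewrite !tens_act0l addr0.
- by rewrite !tens_actDl IHc IHd addrACA.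
- by rewrite !tens_act_pure tens_act1D.
Qed.

Lemma tens_act0r c : tens_act c 0 = 0.
Proof. by apply: (addrI (tens_act c 0)); rewrite -tens_actDr !addr0. Qed.

Fact tens_act1l x :
  tens_act (pure (1 : restrict f A^o) (1 : restrict g B^o)) x = x.
Proof.
rewrite tens_act_pure; elim/(@tens_ind K): x => [|x y IHx IHy|m n].
- by rewrite tens_act10.
- by rewrite tens_act1D IHx IHy.
- by rewrite tens_act1_pure !scale1r.
Qed.

End TensorAction.

Section TensorAlgebra.
Variables (K A B : comPzRingType).
Variables (f : {rmorphism K -> A}) (g : {rmorphism K -> B}).
Local Notation T := (tens_alg f g).

Definition tens_one : T := pure (1 : restrict f A^o) (1 : restrict g B^o).
Definition tens_mul : T -> T -> T := @tens_act K A B f g A^o B^o.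

Lemma tens_actA (M : lmodType A) (N : lmodType B) (c d : T)
    (x : tens_mod f g M N) :
  tens_act c (tens_act d x) = tens_act (tens_mul c d) x.
Proof.
rewrite /tens_mul; elim/(@tens_ind K): c => [|c c' IHc IHc'|a b].
- by rewrite !tens_act0l.
- by rewrite !tens_actDl IHc IHc'.
elim/(@tens_ind K): d => [|d d' IHd IHd'|a' b'].
- by rewrite tens_act0r !tens_act0l tens_act0r.
- by rewrite tens_actDr !tens_actDl !tens_actDr IHd IHd'.
elim/(@tens_ind K): x => [|x y IHx IHy|m n].
- by rewrite !tens_act0r.
- by rewrite !tens_actDr IHx IHy.
rewrite tens_act_pure [in LHS]tens_act_pure [in RHS]tens_act_pure.
rewrite !tens_act1_pure [in RHS]tens_act_pure tens_act1_pure.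
by rewrite -!scalerA.
Qed.

Fact tens_mulA : associative tens_mul.
Proof. by move=> c d e; rewrite /tens_mul tens_actA. Qed.
Fact tens_mulC : commutative tens_mul.
Proof.
move=> c d; rewrite /tens_mul; elim/(@tens_ind K): c => [|c c' IHc IHc'|a b].
- by rewrite tens_act0l tens_act0r.
- by rewrite tens_actDl tens_actDr IHc IHc'.
elim/(@tens_ind K): d => [|d d' IHd IHd'|a' b'].
- by rewrite tens_act0l tens_act0r.
- by rewrite tens_actDl tens_actDr IHd IHd'.
rewrite !tens_act_pure !tens_act1_pure.
by rewrite -[a *: a']/(a * a') -[b *: b']/(b * b') [a * _]mulrC [b * _]mulrC.
Qed.
Fact tens_mul1 : left_id tens_one tens_mul.
Proof. by move=> x; apply: tens_act1l. Qed.
Fact tens_mulDl : left_distributive tens_mul +%R.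
Proof. by move=> x y z; apply: tens_actDl. Qed.

HB.instance Definition _ := GRing.Zmodule_isComPzRing.Build T
  tens_mulA tens_mulC tens_mul1 tens_mulDl.

Lemma tens_mul_pure (a a' : A) (b b' : B) :
  (pure (a : restrict f A^o) (b : restrict g B^o) : T) *
  pure (a' : restrict f A^o) (b' : restrict g B^o) =
  pure (a * a' : restrict f A^o) (b * b' : restrict g B^o).
Proof. by rewrite /GRing.mul /= /tens_mul tens_act_pure tens_act1_pure. Qed.

Definition tens_inl (a : A) : T :=
  pure (a : restrict f A^o) (1 : restrict g B^o).
Definition tens_inr (b : B) : T :=
  pure (1 : restrict f A^o) (b : restrict g B^o).

Fact tens_inl_zmod : zmod_morphism tens_inl.
Proof.
have [pDl _ _] := pure_balanced (restrict f A^o) (restrict g B^o).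
move=> a a'; apply: (addIr (tens_inl a')); rewrite subrK.
by rewrite /tens_inl -pDl subrK.
Qed.
Fact tens_inl_monoid : monoid_morphism tens_inl.
Proof. by split=> // a a'; rewrite /tens_inl tens_mul_pure mulr1. Qed.
HB.instance Definition _ := GRing.isZmodMorphism.Build A T tens_inl tens_inl_zmod.
HB.instance Definition _ :=
  GRing.isMonoidMorphism.Build A T tens_inl tens_inl_monoid.

Fact tens_inr_zmod : zmod_morphism tens_inr.
Proof.
have [_ pDr _] := pure_balanced (restrict f A^o) (restrict g B^o).
move=> b b'; apply: (addIr (tens_inr b')); rewrite subrK.
by rewrite /tens_inr -pDr subrK.
Qed.
Fact tens_inr_monoid : monoid_morphism tens_inr.
Proof. by split=> // b b'; rewrite /tens_inr tens_mul_pure mulr1. Qed.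
HB.instance Definition _ := GRing.isZmodMorphism.Build B T tens_inr tens_inr_zmod.
HB.instance Definition _ :=
  GRing.isMonoidMorphism.Build B T tens_inr tens_inr_monoid.

Lemma tens_in_compat c : tens_inl (f c) = tens_inr (g c).
Proof.
have [_ _ pZ] := pure_balanced (restrict f A^o) (restrict g B^o).
rewrite /tens_inl /tens_inr -[f c]mulr1 -[g c]mulr1.
exact: (pZ c (1 : A) (1 : B)).
Qed.

(* the morphism A (x)_K B -> C, a (x) b |-> p a * q b                        *)
Section AlgLift.
Variables (C : comPzRingType) (p : {rmorphism A -> C}) (q : {rmorphism B -> C}).
Hypothesis pq : forall c, p (f c) = q (g c).

Definition tens_alg_lift (_ : forall c, p (f c) = q (g c)) : T -> C :=
  tens_lift (M := restrict f A^o) (N := restrict g B^o) (fun a b => p a * q b).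

Let lift := tens_alg_lift pq.

Fact tens_alg_lift_balanced :
  balanced (fun (a : restrict f A^o) (b : restrict g B^o) => p a * q b).
Proof.
split=> [a a' b|a b b'|c a b]; rewrite ?rmorphD ?mulrDl ?mulrDr //.
rewrite !restrictZ -[f c *: a]/(f c * a) -[g c *: b]/(g c * b).
by rewrite !rmorphM pq mulrCA mulrA.
Qed.

Lemma tens_alg_lift_pure (a : A) (b : B) :
  lift (pure (a : restrict f A^o) (b : restrict g B^o)) = p a * q b.
Proof. exact: (tens_lift_pure tens_alg_lift_balanced). Qed.

Let liftD : {morph lift : x y / x + y}.
Proof. exact: (tens_liftD tens_alg_lift_balanced). Qed.

Let lift0 : lift 0 = 0.
Proof. exact: (tens_lift0 tens_alg_lift_balanced). Qed.

Fact tens_alg_lift_zmod : zmod_morphism lift.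
Proof. by move=> x y; apply: (addIr (lift y)); rewrite -liftD !subrK. Qed.

Fact tens_alg_lift_monoid : monoid_morphism lift.
Proof.
split=> [|x y]; first by rewrite [LHS]tens_alg_lift_pure !rmorph1 mulr1.
elim/(@tens_ind K): x => [|x x' IHx IHx'|a b].
- by rewrite mul0r lift0 mul0r.
- by rewrite mulrDl !liftD mulrDl IHx IHx'.
elim/(@tens_ind K): y => [|y y' IHy IHy'|a' b'].
- by rewrite mulr0 lift0 mulr0.
- by rewrite mulrDr !liftD mulrDr IHy IHy'.
by rewrite tens_mul_pure !tens_alg_lift_pure !rmorphM mulrACA.
Qed.

HB.instance Definition _ :=
  GRing.isZmodMorphism.Build T C (tens_alg_lift pq) tens_alg_lift_zmod.
HB.instance Definition _ :=
  GRing.isMonoidMorphism.Build T C (tens_alg_lift pq) tens_alg_lift_monoid.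

End AlgLift.

End TensorAlgebra.

Section TensorModule.
Variables (K A B : comPzRingType).
Variables (f : {rmorphism K -> A}) (g : {rmorphism K -> B}).
Variables (M : lmodType A) (N : lmodType B).

HB.instance Definition _ := GRing.Zmodule_isLmodule.Build (tens_alg f g)
  (tens_mod f g M N) (@tens_actA K A B f g M N) (@tens_act1l K A B f g M N)
  (@tens_actDr K A B f g M N) (@tens_actDl K A B f g M N).

End TensorModule.

(* Localization at the powers of s; (q, n) stands for the fraction q / s ^ n *)
Section Localization.
Variables (T : comPzRingType) (s : T) (Q : lmodType T).
Implicit Types (q : Q) (n : nat).

Definition loc_eqv (u v : Q * nat) : Prop :=
  exists j, s ^+ (j + v.2) *: u.1 = s ^+ (j + u.2) *: v.1.

Definition loc_rel : rel (Q * nat) := fun u v => `[< loc_eqv u v >].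

Fact loc_scale m n q : s ^+ m *: (s ^+ n *: q) = s ^+ (m + n) *: q.
Proof. by rewrite scalerA exprD. Qed.

Fact loc_shift c a b m n q q' :
  s ^+ a *: q = s ^+ b *: q' -> m = (c + a)%N -> n = (c + b)%N ->
  s ^+ m *: q = s ^+ n *: q'.
Proof. by move=> e -> ->; rewrite -!loc_scale e. Qed.

Fact loc_rel_equiv : equiv_class_of loc_rel.
Proof.
split=> [u|u v|v u w]; first by apply/asboolP; exists 0.
  by apply/asboolP/asboolP=> -[j e]; exists j.
move=> /asboolP[i e] /asboolP[j e']; apply/asboolP; exists (i + j + v.2)%N.
transitivity (s ^+ (i + j + u.2 + w.2) *: v.1).
  by apply: (loc_shift (c := j + w.2) e); lia.
by apply: (loc_shift (c := i + u.2) e'); lia.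
Qed.

Canonical loc_rel_equivRel := EquivRelPack loc_rel_equiv.
Canonical loc_rel_encModRel := defaultEncModRel loc_rel.

Definition loc_mod : Type := {eq_quot loc_rel}.
HB.instance Definition _ := Choice.on loc_mod.
HB.instance Definition _ := EqQuotient.on loc_mod.

Definition frac q n : loc_mod := \pi_loc_mod (q, n).

Lemma eq_frac q n q' n' : frac q n = frac q' n' <-> loc_eqv (q, n) (q', n').
Proof.
split=> [/eqP|e]; first by rewrite /frac piE => /asboolP.
by apply/eqP; rewrite /frac piE; apply/asboolP.
Qed.

Lemma repr_frac q n : loc_eqv (repr (frac q n)) (q, n).
Proof. by case e: (repr _) => [q' n']; apply/eq_frac; rewrite /frac -e reprK. Qed.

Lemma fracP (x : loc_mod) : {q & {n | x = frac q n}}.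
Proof. by exists (repr x).1, (repr x).2; rewrite /frac -surjective_pairing reprK. Qed.

Lemma frac_scale m q n : frac (s ^+ m *: q) (m + n) = frac q n.
Proof. by apply/eq_frac; exists 0; rewrite /= loc_scale addnC. Qed.

Lemma frac2P (x y : loc_mod) :
  {q & {q' & {n | x = frac q n /\ y = frac q' n}}}.
Proof.
have [[q [n ->]] [q' [n' ->]]] := (fracP x, fracP y).
exists (s ^+ n' *: q), (s ^+ n *: q'), (n' + n)%N.
by rewrite frac_scale addnC frac_scale.
Qed.

Definition loc_zero : loc_mod := frac 0 0.
Definition loc_opp (x : loc_mod) : loc_mod := frac (- (repr x).1) (repr x).2.
Definition loc_add (x y : loc_mod) : loc_mod :=
  let u := repr x in let v := repr y in
  frac (s ^+ v.2 *: u.1 + s ^+ u.2 *: v.1) (u.2 + v.2).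

Lemma loc_add_frac q n q' n' :
  loc_add (frac q n) (frac q' n') =
  frac (s ^+ n' *: q + s ^+ n *: q') (n + n').
Proof.
rewrite /loc_add; move: (repr_frac q n) (repr_frac q' n').
case: (repr _) (repr _) => [p' m'] [p m] /= [i /= e] [i' /= e'].
apply/eq_frac; exists (i + i')%N => /=; rewrite !scalerDr !loc_scale.
congr (_ + _); first by apply: (loc_shift (c := i' + n' + m') e); lia.
by apply: (loc_shift (c := i + n + m) e'); lia.
Qed.

Lemma loc_addE q q' n : loc_add (frac q n) (frac q' n) = frac (q + q') n.
Proof. by rewrite loc_add_frac -scalerDr frac_scale. Qed.

Lemma loc_oppE q n : loc_opp (frac q n) = frac (- q) n.
Proof.
rewrite /loc_opp; case: (repr _) (repr_frac q n) => [p m] [i /= e].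
by apply/eq_frac; exists i; rewrite /= !scalerN e.
Qed.

Lemma frac0 n : frac 0 n = loc_zero.
Proof. by apply/eq_frac; exists 0; rewrite /= !scaler0. Qed.

Fact loc_addC : commutative loc_add.
Proof.
by move=> x y; have [q [q' [n [-> ->]]]] := frac2P x y; rewrite !loc_addE addrC.
Qed.
Fact loc_addA : associative loc_add.
Proof.
move=> x y z; have [q [n ->]] := fracP x; have [q' [n' ->]] := fracP y.
have [q'' [n'' ->]] := fracP z; rewrite !loc_add_frac addnA.
by rewrite !scalerDr !loc_scale addrA [(n + n')%N]addnC [(n'' + n)%N]addnC
  [(n'' + n')%N]addnC.
Qed.
Fact loc_add0 : left_id loc_zero loc_add.
Proof.
by move=> x; have [q [n ->]] := fracP x; rewrite -(frac0 n) loc_addE add0r.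
Qed.
Fact loc_addN : left_inverse loc_zero loc_opp loc_add.
Proof.
by move=> x; have [q [n ->]] := fracP x; rewrite loc_oppE loc_addE addNr frac0.
Qed.

HB.instance Definition _ :=
  GRing.isZmodule.Build loc_mod loc_addA loc_addC loc_add0 loc_addN.

Lemma fracD q q' n : frac (q + q') n = frac q n + frac q' n.
Proof. by rewrite -loc_addE. Qed.

End Localization.

Arguments frac {T} s {Q}.

Definition loc_ring (T : comPzRingType) (s : T) : Type := loc_mod s T^o.

HB.instance Definition _ (T : comPzRingType) (s : T) :=
  GRing.Zmodule.on (loc_ring s).

(* a / s ^ m * (q / s ^ n) = (a q) / s ^ (m + n)                             *)
Definition loc_act (T : comPzRingType) (s : T) (Q : lmodType T)
    (x : loc_ring s) (y : loc_mod s Q) : loc_mod s Q :=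
  let u := repr (x : loc_mod s T^o) in let v := repr y in
  frac s ((u.1 : T) *: v.1) (u.2 + v.2).

Section LocalizedAction.
Variables (T : comPzRingType) (s : T).

Definition fracr (a : T) (n : nat) : loc_ring s := frac s (a : T^o) n.

Lemma fracrP (x : loc_ring s) : {a & {n | x = fracr a n}}.
Proof. exact: (@fracP T s T^o x). Qed.

Lemma fracr2P (x y : loc_ring s) :
  {a & {b & {n | x = fracr a n /\ y = fracr b n}}}.
Proof. exact: (@frac2P T s T^o x y). Qed.

Lemma fracrD a b n : fracr (a + b) n = fracr a n + fracr b n.
Proof. exact: fracD. Qed.

Section Action.
Variable Q : lmodType T.

Lemma loc_actE a m (q : Q) n :
  loc_act (fracr a m) (frac s q n) = frac s (a *: q) (m + n).
Proof.
rewrite /loc_act; move: (repr_frac s (a : T^o) m) (repr_frac s q n).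
case: (repr _) (repr (frac s q n)) => [b m'] [q' n'] /= [i /= e] [i' /= e'].
apply/eq_frac; exists (i + i')%N => /=.
have -> : (i + i' + (m + n) = (i + m) + (i' + n))%N by lia.
have -> : (i + i' + (m' + n') = (i + m') + (i' + n'))%N by lia.
rewrite !scalerA.
have sc (u v c : T) (p : Q) : (u * v * c) *: p = (u * c) *: (v *: p).
  by rewrite scalerA mulrAC.
by rewrite [s ^+ (i + m + (i' + n))]exprD [s ^+ (i + m' + (i' + n'))]exprD
  !sc e' [s ^+ _ * b]e.
Qed.

Lemma loc_actDr : right_distributive (@loc_act T s Q) +%R.
Proof.
move=> x y z; have [a [m ->]] := fracrP x.
have [q [q' [n [-> ->]]]] := frac2P y z.
by rewrite -fracD !loc_actE -fracD scalerDr.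
Qed.

Lemma loc_actDl (y : loc_mod s Q) : {morph (@loc_act T s Q)^~ y : c d / c + d}.
Proof.
move=> c d; have [q [n ->]] := fracP y.
have [a [b [m [-> ->]]]] := fracr2P c d.
by rewrite -fracrD !loc_actE -fracD scalerDl.
Qed.

Lemma loc_act1 (y : loc_mod s Q) : loc_act (fracr 1 0) y = y.
Proof. by have [q [n ->]] := fracP y; rewrite loc_actE scale1r. Qed.

End Action.

Definition loc_mul : loc_ring s -> loc_ring s -> loc_ring s :=
  @loc_act T s T^o.

Lemma loc_mulE a m b n : loc_mul (fracr a m) (fracr b n) = fracr (a * b) (m + n).
Proof. exact: loc_actE. Qed.

Lemma loc_actA (Q : lmodType T) (c d : loc_ring s) (y : loc_mod s Q) :
  loc_act c (loc_act d y) = loc_act (loc_mul c d) y.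
Proof.
have [a [m ->]] := fracrP c; have [b [n ->]] := fracrP d.
by have [q [p ->]] := fracP y; rewrite loc_mulE !loc_actE scalerA addnA.
Qed.

Fact loc_mulA : associative loc_mul.
Proof. by move=> x y z; rewrite /loc_mul loc_actA. Qed.
Fact loc_mulC : commutative loc_mul.
Proof.
move=> x y; have [a [m ->]] := fracrP x; have [b [n ->]] := fracrP y.
by rewrite !loc_mulE mulrC addnC.
Qed.
Fact loc_mul1 : left_id (fracr 1 0) loc_mul.
Proof. by move=> x; apply: loc_act1. Qed.
Fact loc_mulDl : left_distributive loc_mul +%R.
Proof. by move=> x y z; apply: loc_actDl. Qed.

HB.instance Definition _ := GRing.Zmodule_isComPzRing.Build (loc_ring s)
  loc_mulA loc_mulC loc_mul1 loc_mulDl.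

Lemma fracrM a m b n : fracr a m * fracr b n = fracr (a * b) (m + n).
Proof. exact: loc_mulE. Qed.

HB.instance Definition _ (Q : lmodType T) :=
  GRing.Zmodule_isLmodule.Build (loc_ring s) (loc_mod s Q)
    (@loc_actA Q) (@loc_act1 Q) (@loc_actDr Q) (@loc_actDl Q).

Definition loc_in (a : T) : loc_ring s := fracr a 0.

Fact loc_in_zmod : zmod_morphism loc_in.
Proof.
by move=> a b; apply: (addIr (loc_in b)); rewrite /loc_in -fracrD !subrK.
Qed.
Fact loc_in_monoid : monoid_morphism loc_in.
Proof. by split=> // a b; rewrite /loc_in fracrM. Qed.
HB.instance Definition _ :=
  GRing.isZmodMorphism.Build T (loc_ring s) loc_in loc_in_zmod.
HB.instance Definition _ :=
  GRing.isMonoidMorphism.Build T (loc_ring s) loc_in loc_in_monoid.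

End LocalizedAction.

(* the morphism a / s ^ n |-> h a / (h s) ^ n                                *)
Section LocalizedMorphism.
Variables (T T' : comPzRingType) (h : {rmorphism T -> T'}) (s : T).

Definition loc_map (x : loc_ring s) : loc_ring (h s) :=
  let u := repr (x : loc_mod s T^o) in fracr (h s) (h u.1) u.2.

Lemma loc_mapE a n : loc_map (fracr s a n) = fracr (h s) (h a) n.
Proof.
rewrite /loc_map; case: (repr _) (repr_frac s (a : T^o) n) => [b m] [i /= e].
apply/eq_frac; exists i => /=.
by rewrite -!rmorphXn -[LHS]rmorphM -[RHS]rmorphM; congr (h _).
Qed.

Fact loc_map_zmod : zmod_morphism loc_map.
Proof.
move=> x y; apply: (addIr (loc_map y)); rewrite subrK.
rewrite -{2}[x](subrK y); move: (x - y) => {}x.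
have [a [b [n [-> ->]]]] := fracr2P x y.
by rewrite -fracrD !loc_mapE rmorphD fracrD.
Qed.
Fact loc_map_monoid : monoid_morphism loc_map.
Proof.
split=> [|x y]; first by rewrite [LHS]loc_mapE rmorph1.
have [a [m ->]] := fracrP x; have [b [n ->]] := fracrP y.
by rewrite fracrM !loc_mapE rmorphM fracrM.
Qed.
HB.instance Definition _ :=
  GRing.isZmodMorphism.Build _ _ loc_map loc_map_zmod.
HB.instance Definition _ :=
  GRing.isMonoidMorphism.Build _ _ loc_map loc_map_monoid.

End LocalizedMorphism.

(* the morphism A (x)_K B_t -> (A (x)_K B)_t,                                *)
(*   a (x) (b / t ^ n) |-> (a (x) b) / (1 (x) t) ^ n                         *)
Section LocalizedTensor.
Variables (K A B : comPzRingType).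
Variables (f : {rmorphism K -> A}) (g : {rmorphism K -> B}) (t : B).
Local Notation tau := (tens_inr f g t).

Fact loc_tens_compat c :
  (loc_in tau \o tens_inl f g) (f c) =
  loc_map (tens_inr f g) ((loc_in t \o g) c).
Proof. by rewrite /= tens_in_compat [RHS]loc_mapE. Qed.

Definition loc_tens : tens_alg f (loc_in t \o g) -> loc_ring tau :=
  tens_alg_lift loc_tens_compat.

HB.instance Definition _ := GRing.RMorphism.on loc_tens.

End LocalizedTensor.

Arguments loc_tens {K A B} f g t.

Section QuotientModule.
Variables (T : comPzRingType) (s : T) (Q : lmodType T).

Definition smul_pred : {pred Q} := fun q => `[< exists u, q = s *: u >].

Fact smul_zmod_closed : zmod_closed smul_pred.
Proof.
split=> [|_ _ /asboolP[u ->] /asboolP[v ->]]; apply/asboolP.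
  by exists 0; rewrite scaler0.
by exists (u - v); rewrite scalerBr.
Qed.
HB.instance Definition _ := GRing.isZmodClosed.Build Q smul_pred smul_zmod_closed.

Definition quot_mod : Type := Quotient.quot smul_pred.
HB.instance Definition _ := Choice.on quot_mod.
HB.instance Definition _ := EqQuotient.on quot_mod.
HB.instance Definition _ := GRing.Zmodule.on quot_mod.

Definition to_quot (q : Q) : quot_mod := \pi_quot_mod q.

Lemma eq_to_quot q q' : to_quot q = to_quot q' <-> exists u, q - q' = s *: u.
Proof.
split=> [/eqP|e]; first by rewrite -Quotient.idealrBE => /asboolP.
by apply/eqP; rewrite -Quotient.idealrBE; apply/asboolP.
Qed.

Lemma to_quotK (x : quot_mod) : to_quot (repr x) = x.
Proof. exact: reprK. Qed.

Lemma to_quotD : {morph to_quot : x y / x + y}.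
Proof. exact: (Quotient.pi_add smul_pred). Qed.

Definition quot_scale (c : T) (x : quot_mod) : quot_mod := to_quot (c *: repr x).

Lemma quot_scaleE c q : quot_scale c (to_quot q) = to_quot (c *: q).
Proof.
have /eq_to_quot[u e] := to_quotK (to_quot q).
by apply/eq_to_quot; exists (c *: u); rewrite -scalerBr e !scalerA mulrC.
Qed.

Fact quot_scaleA a b v : quot_scale a (quot_scale b v) = quot_scale (a * b) v.
Proof. by rewrite -[v]to_quotK !quot_scaleE scalerA. Qed.
Fact quot_scale1 : left_id 1 quot_scale.
Proof. by move=> v; rewrite -[v]to_quotK quot_scaleE scale1r. Qed.
Fact quot_scaleDr : right_distributive quot_scale +%R.
Proof.
move=> a u v; rewrite -[u]to_quotK -[v]to_quotK -to_quotD !quot_scaleE.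
by rewrite scalerDr to_quotD.
Qed.
Fact quot_scaleDl v : {morph quot_scale^~ v : a b / a + b}.
Proof.
by move=> a b; rewrite -[v]to_quotK !quot_scaleE scalerDl to_quotD.
Qed.

HB.instance Definition _ := GRing.Zmodule_isLmodule.Build T quot_mod
  quot_scaleA quot_scale1 quot_scaleDr quot_scaleDl.

End QuotientModule.

Definition fin_gen (T : pzRingType) (Q : lmodType T) : Prop :=
  exists (n : nat) (e : 'I_n -> Q), forall q, exists c : 'I_n -> T,
    q = \sum_i c i *: e i.

Definition lmod_iso (T : pzRingType) (M N : lmodType T) : Prop :=
  exists h : {linear M -> N}, bijective h.

Section Ideal.
Variables (A : comPzRingType) (s : seq A).

Definition ideal : {pred A^o} := fun r : A^o =>
  `[< exists c : 'I_(size s) -> A, r = \sum_i c i * s`_i >].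

Fact ideal_submod_closed : GRing.submod_closed ideal.
Proof.
split; first by apply/asboolP; exists (fun=> 0); rewrite big1 // => i _; rewrite mul0r.
move=> a _ _ /asboolP[c ->] /asboolP[d ->]; apply/asboolP.
exists (fun i => a * c i + d i); rewrite scaler_sumr -big_split /=.
by apply: eq_bigr => i _; rewrite mulrDl -mulrA.
Qed.
HB.instance Definition _ :=
  GRing.isSubmodClosed.Build A A^o ideal ideal_submod_closed.

Record ideal_mod : Type := IdealMod {ideal_val : A^o; _ : ideal_val \in ideal}.
HB.instance Definition _ := [isSub for ideal_val].
HB.instance Definition _ := [Choice of ideal_mod by <:].
HB.instance Definition _ := [SubChoice_isSubLmodule of ideal_mod by <:].

End Ideal.

Section Dvr.
Variable V : idomainType.
Implicit Types (I J : {pred V^o}).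

Definition is_ideal I : Prop := GRing.submod_closed I.

Definition maximal_ideal I : Prop :=
  [/\ is_ideal I, 1 \notin I &
    forall J, is_ideal J -> 1 \notin J -> {subset I <= J} -> J =i I].

(* a local principal ideal domain, not a field, with maximal ideal t V       *)
Definition dvr (t : V) : Prop :=
  [/\ forall I, is_ideal I -> exists a, I =i ideal [:: a],
      t != 0,
      maximal_ideal (ideal [:: t])
    & forall I, maximal_ideal I -> I =i ideal [:: t]].

End Dvr.

(* M degenerates to N.  The residue field V / t V is k: the structure        *)
(* morphism k -> V / t V is bijective.  The localization Q_t is a module     *)
(* over (R (x)_k V)_t, hence over R (x)_k V_t through loc_tens.              *)
Definition degenerates (k : fieldType) (R : comNzRingType)
    (f : {rmorphism k -> R}) (M N : lmodType R) : Prop :=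
  exists (V : idomainType) (g : {rmorphism k -> V}) (t : V),
  [/\ dvr t,
      bijective (fun c : k => to_quot t (g c : V^o))
    & exists Q : lmodType (tens_alg f g),
      [/\ fin_gen Q,
          flat (restrict (tens_inr f g) Q),
          lmod_iso (restrict (tens_inl f g) (quot_mod (tens_inr f g t) Q)) N
        & lmod_iso (restrict (loc_tens f g t) (loc_mod (tens_inr f g t) Q))
            (tens_mod f (loc_in t \o g) M (loc_ring t)^o)]].

(* k[[x, y, z]]; f i j l is the coefficient of x ^ i y ^ j z ^ l             *)
Definition pseries3 (k : Type) : Type := nat -> nat -> nat -> k.

Section PowerSeries.
Variable k : comNzRingType.
Local Notation P := (pseries3 k).

HB.instance Definition _ := Choice.copy P (nat -> nat -> nat -> k).

Definition ps_monom (a b c : nat) : P := fun i j l =>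
  ((i == a) && (j == b) && (l == c))%:R.
Definition ps_add (f g : P) : P := fun i j l => f i j l + g i j l.
Definition ps_opp (f : P) : P := fun i j l => - f i j l.
Definition ps_const (c : k) : P := fun i j l =>
  if (i == 0) && (j == 0) && (l == 0) then c else 0.
Definition ps_mul (f g : P) : P := fun i j l =>
  \sum_(a < i.+1) \sum_(b < j.+1) \sum_(c < l.+1)
     f a b c * g (i - a)%N (j - b)%N (l - c)%N.

Lemma ps_ext (f g : P) : (forall i j l, f i j l = g i j l) -> f = g.
Proof.
by move=> fg; apply: funext => i; apply: funext => j; apply: funext => l.
Qed.

Fact ps_addA : associative ps_add.
Proof. by move=> f g h; apply: ps_ext => i j l; rewrite /ps_add addrA. Qed.
Fact ps_addC : commutative ps_add.
Proof. by move=> f g; apply: ps_ext => i j l; rewrite /ps_add addrC. Qed.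
Fact ps_add0 : left_id (ps_const 0) ps_add.
Proof.
by move=> f; apply: ps_ext => i j l; rewrite /ps_add /ps_const if_same add0r.
Qed.
Fact ps_addN : left_inverse (ps_const 0) ps_opp ps_add.
Proof.
move=> f; apply: ps_ext => i j l.
by rewrite /ps_add /ps_const if_same /ps_opp addNr.
Qed.

HB.instance Definition _ := GRing.isZmodule.Build P ps_addA ps_addC ps_add0 ps_addN.

Let trunc n (f : P) : {poly {poly {poly k}}} :=
  \poly_(i < n) \poly_(j < n) \poly_(l < n) f i j l.

Let coef_trunc n f i j l : (i < n)%N -> (j < n)%N -> (l < n)%N ->
  (trunc n f)`_i`_j`_l = f i j l.
Proof. by move=> li lj ll; rewrite coef_poly li coef_poly lj coef_poly ll. Qed.

Let coef3M (p q : {poly {poly {poly k}}}) i j l : (p * q)`_i`_j`_l =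
  \sum_(a < i.+1) \sum_(b < j.+1) \sum_(c < l.+1)
     p`_a`_b`_c * q`_(i - a)`_(j - b)`_(l - c).
Proof.
rewrite coefM !coef_sum; apply: eq_bigr => a _.
by rewrite coefM coef_sum; apply: eq_bigr => b _; rewrite coefM.
Qed.

Let ps_mulE n f g i j l : (i < n)%N -> (j < n)%N -> (l < n)%N ->
  ps_mul f g i j l = (trunc n f * trunc n g)`_i`_j`_l.
Proof.
move=> li lj ll; rewrite coef3M.
by do 3![apply: eq_bigr => -[? /= ?] _]; rewrite !coef_trunc //; lia.
Qed.

Fact ps_mulC : commutative ps_mul.
Proof.
move=> f g; apply: ps_ext => i j l; have [n [ni nj nl]] : exists n, [/\ i < n, j < n & l < n]%N.
  by exists (i + j + l).+1; split; lia.
by rewrite !(@ps_mulE n) 1?mulrC //; lia.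
Qed.
Fact ps_mulA : associative ps_mul.
Proof.
move=> f g h; apply: ps_ext => i j l; have [n [ni nj nl]] : exists n, [/\ i < n, j < n & l < n]%N.
  by exists (i + j + l).+1; split; lia.
transitivity (trunc n f * (trunc n g * trunc n h))`_i`_j`_l.
  rewrite coef3M; do 3![apply: eq_bigr => -[? /= ?] _].
  by rewrite coef_trunc ?(@ps_mulE n) //; lia.
rewrite mulrA coef3M; do 3![apply: eq_bigr => -[? /= ?] _].
by rewrite coef_trunc -?(@ps_mulE n) //; lia.
Qed.
Fact ps_mulDl : left_distributive ps_mul +%R.
Proof.
move=> f g h; apply: ps_ext => i j l; rewrite /GRing.add /= /ps_add /ps_mul.
by rewrite -big_split; do 3![apply: eq_bigr => ? _; rewrite -?big_split /=];
  rewrite mulrDl.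
Qed.
Lemma ps_constM c f i j l : ps_mul (ps_const c) f i j l = c * f i j l.
Proof.
rewrite /ps_mul big_ord_recl big_ord_recl big_ord_recl /ps_const /= !subn0.
by do 3![rewrite big1 ?addr0 // => *; do ?[apply: big1 => *]; rewrite /= ?mul0r //].
Qed.
Fact ps_mul1 : left_id (ps_const 1) ps_mul.
Proof. by move=> f; apply: ps_ext => i j l; rewrite ps_constM mul1r. Qed.
Fact ps_1neq0 : ps_const 1 != 0.
Proof.
apply/eqP => /(congr1 (fun f : P => f 0 0 0)) /eqP.
by rewrite /ps_const /= oner_eq0.
Qed.

HB.instance Definition _ := GRing.Zmodule_isComNzRing.Build P
  ps_mulA ps_mulC ps_mul1 ps_mulDl ps_1neq0.

Fact ps_const_zmod : zmod_morphism ps_const.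
Proof.
move=> c d; apply: ps_ext => i j l; rewrite /ps_const.
rewrite -[RHS]/((if _ then c else 0) - (if _ then d else 0)).
by case: ifP => // _; rewrite subr0.
Qed.
Fact ps_const_monoid : monoid_morphism ps_const.
Proof.
split=> // c d; apply: ps_ext => i j l.
by rewrite [RHS]ps_constM /ps_const; case: ifP => // _; rewrite mulr0.
Qed.
HB.instance Definition _ := GRing.isZmodMorphism.Build k P ps_const ps_const_zmod.
HB.instance Definition _ :=
  GRing.isMonoidMorphism.Build k P ps_const ps_const_monoid.

Definition psX : P := ps_monom 1 0 0.
Definition psY : P := ps_monom 0 1 0.
Definition psZ : P := ps_monom 0 0 1.

Definition xy_ideal : {pred P} := ideal [:: psX * psY].

Fact xy_idealr_closed : idealr_closed xy_ideal.
Proof.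
have [I0 IZD] := ideal_submod_closed [:: psX * psY]; split; [by []| |exact: IZD].
apply/asboolP=> -[c]; rewrite big_ord1 /= => /(congr1 (fun f : P => f 0 0 0)).
move/eqP; rewrite -[c _ * _]/(ps_mul (c ord0) (ps_mul psX psY)) /ps_mul.
rewrite !big_ord1 /= /psX /psY /ps_monom /= mul0r mulr0.
by rewrite -[(1 : P) 0 0 0]/(1 : k) oner_eq0.
Qed.
HB.instance Definition _ := isIdealr.Build P xy_ideal xy_idealr_closed.

Definition Rxy : Type := {ideal_quot xy_ideal}.
HB.instance Definition _ := GRing.ComNzRing.on Rxy.

Definition proj_xy (f : P) : Rxy := \pi_{ideal_quot xy_ideal} f.
Fact proj_xy_zmod : zmod_morphism proj_xy.
Proof. exact: (pi_is_zmod_morphism {ideal_quot xy_ideal}). Qed.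
Fact proj_xy_monoid : monoid_morphism proj_xy.
Proof. exact: (pi_is_monoid_morphism {ideal_quot xy_ideal}). Qed.
HB.instance Definition _ := GRing.isZmodMorphism.Build P Rxy proj_xy proj_xy_zmod.
HB.instance Definition _ :=
  GRing.isMonoidMorphism.Build P Rxy proj_xy proj_xy_monoid.

Definition Rxy_x : Rxy := proj_xy psX.
Definition Rxy_y : Rxy := proj_xy psY.
Definition Rxy_z : Rxy := proj_xy psZ.

Definition Rxy_in (c : k) : Rxy := proj_xy (ps_const c).
HB.instance Definition _ := GRing.RMorphism.copy Rxy_in (proj_xy \o ps_const).

Definition xz_ideal (a : nat) : lmodType Rxy := ideal_mod [:: Rxy_x; Rxy_z ^+ a].
Definition yz_ideal (a : nat) : lmodType Rxy := ideal_mod [:: Rxy_y; Rxy_z ^+ a].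

End PowerSeries.

Arguments Rxy_in : clear implicits.
Arguments xz_ideal : clear implicits.
Arguments yz_ideal : clear implicits.

(* Main.v *)
From HB Require Import structures.
Require Import Defs.
From mathcomp Require Import all_boot all_algebra.
From mathcomp Require Import boolp.

Set Implicit Arguments.
Unset Strict Implicit.
Unset Printing Implicit Defensive.

Import GRing.Theory.

Local Open Scope ring_scope.

(** If an ideal [M] containing [z ^ a] degenerates to [N = (x, z ^ b)], then
    [z ^ b] divides [z ^ a] in [k[[z]]]; exchanging [x] and [y] gives the same
    for [N = (y, z ^ b)], and both [(x, z ^ a)] and [(y, z ^ a)] contain
    [z ^ a].  So no degeneration exists when [a < b].

    Let [Q] be the family, flat over the valuation ring [V], with special
    fibre [N].  The module [N] is generated by [e1 = x] and [e2 = z ^ b], with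
    [y e1 = 0] and [x e2 = z ^ b e1].

    On the side of [N], the obstruction to lifting [e1] together with its
    relation [y e1 = 0] lies in [Ext^1 (R / y, N) = Ann_N(x) / y N], which
    vanishes; hence there are lifts [E1] of [e1] with [y E1] divisible by any
    prescribed power [t ^ n] ([lift_annihilated]).  Since [Ann_N(y) = R e1],
    every element of [Q] annihilated by [y] modulo [t ^ n] is a multiple of
    [E1] modulo [t ^ n] ([approx_multiple]); in particular
    [x E2 = (z ^ b + t c) E1] modulo [t ^ n] for a lift [E2] of [e2].

    On the side of [M], the inclusion of [M] in [R], the isomorphism of the
    generic fibre with [M (x) V_t] and the expansion of elements of [V] as
    power series in [t] give, once denominators are cleared, a semilinear map
    [Phi : Q -> R[[t]]], and some [eps] in [Q] with [Phi eps = t ^ m z ^ a]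
    ([lattice_series_coord]).

    Take [n > m] and write [eps = c1 E1 + c2 E2] modulo [t ^ n].  As [y]
    annihilates [Phi E1] modulo [t ^ n], we have [Phi E1 = x d] there, and
    multiplying by [x] gives
      [x t ^ m z ^ a = x (c1 x + c2 (z ^ b + t c)) d]  modulo [t ^ n].
    The annihilator of [x] being [y R], cancelling [x] and restricting to the
    axis [x = y = 0] yields [t ^ m z ^ a = c2 d (z ^ b + t c)] in
    [k[[z]][[t]] / t ^ n]; comparing the first nonzero coefficients in [t]
    shows that [z ^ b] divides [z ^ a] ([dvd_of_family]). *)

(** * Power series in one variable *)

Definition series (A : Type) : Type := nat -> A.

Section Series.
Variable A : comNzRingType.
Implicit Types f g h : series A.

HB.instance Definition _ := Choice.copy (series A) (nat -> A).

Definition series_const (c : A) : series A := fun i => if i is 0 then c else 0.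
Definition series_var : series A := fun i => (i == 1)%:R.
Definition series_add f g : series A := fun i => f i + g i.
Definition series_opp f : series A := fun i => - f i.
Definition series_mul f g : series A := fun i => \sum_(j < i.+1) f j * g (i - j)%N.

Fact series_addA : associative series_add.
Proof. by move=> f g h; apply: funext => i; apply: addrA. Qed.
Fact series_addC : commutative series_add.
Proof. by move=> f g; apply: funext => i; apply: addrC. Qed.
Fact series_add0 : left_id (series_const 0) series_add.
Proof. by move=> f; apply: funext => -[|i]; apply: add0r. Qed.
Fact series_addN : left_inverse (series_const 0) series_opp series_add.
Proof. by move=> f; apply: funext => -[|i]; apply: addNr. Qed.

HB.instance Definition _ :=
  GRing.isZmodule.Build (series A) series_addA series_addC series_add0 series_addN.

Lemma coef_seriesD f g i : (f + g) i = f i + g i. Proof. by []. Qed.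
Lemma coef_seriesN f i : (- f) i = - f i. Proof. by []. Qed.
Lemma coef_series0 i : (0 : series A) i = 0. Proof. by case: i. Qed.

(** Each coefficient of a product of series is one of a product of truncated
    polynomials, so the ring axioms are inherited from polynomials. *)
Let trunc n f : {poly A} := \poly_(i < n) f i.

Let series_mulE n f g i : (i < n)%N ->
  series_mul f g i = (trunc n f * trunc n g)`_i.
Proof.
move=> lin; rewrite coefM; apply: eq_bigr => -[j /= lji] _.
rewrite !coef_poly (leq_ltn_trans _ lin) ?(leq_ltn_trans (leq_subr _ _) lin) //.
Qed.

Fact series_mulC : commutative series_mul.
Proof.
by move=> f g; apply: funext => i; rewrite !(series_mulE (n := i.+1)) // mulrC.
Qed.
Fact series_mulA : associative series_mul.
Proof.
move=> f g h; apply: funext => i.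
transitivity (trunc i.+1 f * (trunc i.+1 g * trunc i.+1 h))`_i.
  rewrite coefM; apply: eq_bigr => -[j /= lji] _.
  by rewrite coef_poly lji (series_mulE (n := i.+1)) // ltnS leq_subr.
rewrite mulrA coefM; apply: eq_bigr => -[j /= lji] _.
by rewrite coef_poly ltnS leq_subr -series_mulE.
Qed.
Fact series_constM c f i : series_mul (series_const c) f i = c * f i.
Proof.
by rewrite /series_mul big_ord_recl subn0 big1 ?addr0 // => j _; rewrite mul0r.
Qed.
Fact series_mul1 : left_id (series_const 1) series_mul.
Proof. by move=> f; apply: funext => i; rewrite series_constM mul1r. Qed.
Fact series_mulDl : left_distributive series_mul +%R.
Proof.
move=> f g h; apply: funext => i; rewrite coef_seriesD -big_split.
by apply: eq_bigr => j _; rewrite coef_seriesD mulrDl.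
Qed.
Fact series_1neq0 : series_const 1 != 0.
Proof. by apply/eqP => /(congr1 (fun f => f 0%N))/eqP; rewrite oner_eq0. Qed.

HB.instance Definition _ := GRing.Zmodule_isComNzRing.Build (series A)
  series_mulA series_mulC series_mul1 series_mulDl series_1neq0.

Lemma coef_seriesM f g i : (f * g) i = \sum_(j < i.+1) f j * g (i - j)%N.
Proof. by []. Qed.

Lemma coef_constM c f i : (series_const c * f) i = c * f i.
Proof. exact: series_constM. Qed.

Fact series_const_zmod : zmod_morphism series_const.
Proof.
by move=> c d; apply: funext => -[|i] //; apply/esym/subr0.
Qed.
Fact series_const_monoid : monoid_morphism series_const.
Proof.
split=> // c d; apply: funext => i; rewrite coef_constM.
by case: i => // i; rewrite mulr0.
Qed.
HB.instance Definition _ :=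
  GRing.isZmodMorphism.Build A (series A) series_const series_const_zmod.
HB.instance Definition _ :=
  GRing.isMonoidMorphism.Build A (series A) series_const series_const_monoid.

Lemma coef_varM f i : (series_var * f) i = if i is j.+1 then f j else 0.
Proof.
rewrite coef_seriesM; case: i => [|i]; first by rewrite big_ord1 mul0r.
rewrite !big_ord_recl /series_var /= mul0r mul1r add0r subSS subn0.
by rewrite big1 ?addr0 // => j _; rewrite mul0r.
Qed.

Lemma coef_varXM n f i :
  (series_var ^+ n * f) i = if (i < n)%N then 0 else f (i - n)%N.
Proof.
elim: n i => [|n IHn] i; first by rewrite mul1r subn0.
by rewrite exprS -mulrA coef_varM; case: i => // i; rewrite IHn.
Qed.

Lemma series_var_dvdP n f :
  (forall i, (i < n)%N -> f i = 0) <-> exists g, f = series_var ^+ n * g.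
Proof.
split=> [f0|[g ->] i lin]; last by rewrite coef_varXM lin.
exists (fun i => f (n + i)%N); apply: funext => i; rewrite coef_varXM.
by case: ltnP => [/f0|/subnKC->].
Qed.

(** Hence [A[[t]]] embeds in its localization at [t]. *)
Lemma series_varX_inj n : injective ( *%R (series_var ^+ n)).
Proof.
move=> f g /(congr1 (fun h : series A => h (n + _)%N)) fg; apply: funext => i.
by move: (fg i); rewrite !coef_varXM ltnNge leq_addr addKn.
Qed.

End Series.

Arguments series_const {A}.
Arguments series_var {A}.

Section SeriesMap.
Variables (A B : comNzRingType) (rho : {rmorphism A -> B}).

Definition series_map (f : series A) : series B := fun i => rho (f i).

Fact series_map_zmod : zmod_morphism series_map.
Proof. by move=> f g; apply: funext => i; apply: rmorphB. Qed.
Fact series_map_monoid : monoid_morphism series_map.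
Proof.
split=> [|f g]; apply: funext => i.
  by case: i => [|i]; rewrite /series_map ?rmorph1 ?rmorph0.
rewrite /series_map !coef_seriesM rmorph_sum.
by apply: eq_bigr => j _; rewrite rmorphM.
Qed.
HB.instance Definition _ :=
  GRing.isZmodMorphism.Build (series A) (series B) series_map series_map_zmod.
HB.instance Definition _ :=
  GRing.isMonoidMorphism.Build (series A) (series B) series_map series_map_monoid.

Lemma series_map_const c : series_map (series_const c) = series_const (rho c).
Proof. by apply: funext => -[|i]; rewrite /series_map ?rmorph0. Qed.

Lemma series_map_var : series_map series_var = series_var.
Proof. by apply: funext => i; apply: rmorph_nat. Qed.

End SeriesMap.

Section SeriesDivision.
Variable A : comNzRingType.

(** Modulo [t], the factor [c + t q] is the regular element [c]; so [p] starts
    in degree [m] and the coefficients of degree [m] satisfy [c p_m = a]. *)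
Lemma series_leading_dvd (c a : A) (p q : series A) m :
  injective ( *%R c) ->
  (forall i, (i <= m)%N ->
    (p * (series_const c + series_var * q)) i =
    (series_var ^+ m * series_const a) i) ->
  a = c * p m.
Proof.
move=> c_reg pq.
have coef i : (forall j, (j < i)%N -> p j = 0) ->
    (p * (series_const c + series_var * q)) i = c * p i.
  move=> p0; rewrite mulrC mulrDl coef_seriesD coef_constM -mulrA coef_varM.
  case: i p0 => [|i] p0; first by rewrite addr0.
  rewrite coef_seriesM big1 ?addr0 // => j _.
  by rewrite p0 ?mulr0 // ltnS leq_subr.
have p0 i : (i < m)%N -> p i = 0.
  elim/ltn_ind: i => i IHi im; apply: c_reg; rewrite mulr0 -coef.
    by rewrite pq 1?ltnW // coef_varXM im.
  by move=> j ji; apply: IHi => //; apply: ltn_trans ji im.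
by rewrite -coef // pq // coef_varXM ltnn subnn.
Qed.

(** Divisibility by [x] of the coefficients of degree less than [n] is
    divisibility of the series by [x] modulo [t ^ n]. *)
Lemma series_split (x : A) n (f : series A) :
  (forall i, (i < n)%N -> exists s, f i = x * s) ->
  exists d p, f = series_const x * d + series_var ^+ n * p.
Proof.
move=> fx; have fx' i : exists s, (i < n)%N -> f i = x * s.
  by case: (ltnP i n) => [/fx[s e]|_]; [exists s | exists 0].
pose d : series A := fun i => sval (cid (fx' i)).
have [p e] : exists p, f - series_const x * d = series_var ^+ n * p.
  apply/series_var_dvdP => i lin.
  by rewrite coef_seriesD coef_seriesN coef_constM -(svalP (cid (fx' i))) ?subrr.
by exists d, p; rewrite -e addrC subrK.
Qed.

End SeriesDivision.

(** * Expansion of the elements of a discrete valuation ring *)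

Section Expansion.
Variables (k : comNzRingType) (V : idomainType) (g : {rmorphism k -> V}) (t : V).
(* A single hypothesis, so that the morphism structures below depend only on
   data that occur in the expansion itself. *)
Hypothesis unif : t != 0 /\ bijective (fun c => to_quot t (g c : V^o)).

Fact expansion_step v : exists w : k * V, v = g w.1 + t * w.2.
Proof.
have [_ [r _ rK]] := unif; have /eq_to_quot[u e] := rK (to_quot t (v : V^o)).
exists (r (to_quot t (v : V^o)), - u) => /=.
by rewrite mulrN -[t * u]e opprB addrC subrK.
Qed.

Definition residue v : k := (sval (cid (expansion_step v))).1.
Definition tail v : V := (sval (cid (expansion_step v))).2.

Lemma residueE v : v = g (residue v) + t * tail v.
Proof. exact: (svalP (cid (expansion_step v))). Qed.

Lemma residue_tail_uniq c c' u u' :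
  g c + t * u = g c' + t * u' -> c = c' /\ u = u'.
Proof.
move=> e; have ecc' : c = c'.
  apply: (bij_inj unif.2); apply/eq_to_quot; exists (u' - u).
  rewrite -[RHS]/(t * (u' - u)) mulrBr; apply/eqP.
  by rewrite subr_eq addrAC eq_sym subr_eq addrC e addrC.
split=> //; move: e; rewrite ecc' => /addrI; exact: (mulfI unif.1).
Qed.

Lemma residue_tail c u : residue (g c + t * u) = c /\ tail (g c + t * u) = u.
Proof. by apply: residue_tail_uniq; rewrite -residueE. Qed.

(** The completion map [V -> k[[t]]]: the digits of [v] are the successive
    residues. *)
Definition expansion (v : V) : series k := fun i => residue (iter i tail v).

Lemma expansion0 v : expansion v 0 = residue v. Proof. by []. Qed.

Lemma expansionS v i : expansion v i.+1 = expansion (tail v) i.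
Proof. by rewrite /expansion iterSr. Qed.

Lemma expansion_const c : expansion (g c) = series_const c.
Proof.
have tail0 i : iter i tail 0 = 0.
  elim: i => // i IHi; rewrite /= IHi.
  by rewrite -[X in tail X](mulr0 t) -[X in tail X]add0r -(rmorph0 g)
    (residue_tail _ _).2.
have [r0 s0] := residue_tail c 0; rewrite mulr0 addr0 in r0 s0.
apply: funext => -[|i]; first exact: r0.
rewrite expansionS s0 /expansion tail0.
by have [] := residue_tail 0 0; rewrite rmorph0 mulr0 addr0.
Qed.

Lemma expansion_var : expansion t = series_var.
Proof.
have [r0 s0] := residue_tail 0 1; rewrite rmorph0 mulr1 add0r in r0 s0.
apply: funext => -[|i]; first exact: r0.
by rewrite expansionS s0 -(rmorph1 g) expansion_const; case: i.
Qed.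

Fact expansion_zmod : zmod_morphism expansion.
Proof.
move=> u v; apply: funext => i; rewrite coef_seriesD coef_seriesN.
have rt u' v' : residue (u' - v') = residue u' - residue v' /\
    tail (u' - v') = tail u' - tail v'.
  have <- : g (residue u' - residue v') + t * (tail u' - tail v') = u' - v'.
    by rewrite rmorphB mulrBr addrACA -opprD -!residueE.
  exact: residue_tail.
elim: i u v => [|i IHi] u v; first exact: (rt u v).1.
by rewrite !expansionS (rt u v).2 IHi.
Qed.

HB.instance Definition _ :=
  GRing.isZmodMorphism.Build V (series k) expansion expansion_zmod.

(** Both sides satisfy the recursion coming from
    [u v = u_0 v + t (tail u) v], where [u_0] is the residue of [u]; the case of
    a constant factor has to be treated first. *)
Fact expansion_monoid : monoid_morphism expansion.
Proof.
have scale c v : expansion (g c * v) = series_const c * expansion v.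
  apply: funext => i; rewrite coef_constM; elim: i v => [|i IHi] v.
    rewrite !expansion0 [X in g c * X]residueE mulrDr -rmorphM mulrCA.
    exact: (residue_tail _ _).1.
  rewrite !expansionS -IHi [X in g c * X]residueE mulrDr -rmorphM mulrCA.
  by rewrite (residue_tail _ _).2.
split=> [|u v]; first by rewrite -(rmorph1 g) expansion_const.
apply: funext => i; elim: i u v => [|i IHi] u v.
  rewrite coef_seriesM big_ord1 !expansion0 {1}[u]residueE {1}[v]residueE.
  rewrite mulrDl !mulrDr -rmorphM -!mulrA mulrCA -addrA -!mulrDr.
  exact: (residue_tail _ _).1.
have -> : u * v = g (residue u) * v + t * (tail u * v).
  by rewrite mulrA -mulrDl -residueE.
rewrite raddfD /= coef_seriesD scale coef_constM coef_seriesM big_ord_recl.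
congr (_ + _); rewrite expansionS -[t * _]add0r -(rmorph0 g) (residue_tail _ _).2.
by rewrite IHi coef_seriesM; apply: eq_bigr => j _; rewrite -expansionS.
Qed.

HB.instance Definition _ :=
  GRing.isMonoidMorphism.Build V (series k) expansion expansion_monoid.

End Expansion.

(** * Coordinates of a family in the power series over the base ring *)

Section TensAlg.
Variables (K A B : comPzRingType) (f : {rmorphism K -> A}) (g : {rmorphism K -> B}).

(** Inductions on products of the two canonical images keep the terms within
    the ring [A (x) B], where morphisms can be rewritten. *)
Lemma tens_alg_ind (P : tens_alg f g -> Prop) :
  P 0 -> (forall c d, P c -> P d -> P (c + d)) ->
  (forall a b, P (tens_inl f g a * tens_inr f g b)) -> forall c, P c.
Proof.
move=> P0 PD PM; apply: tens_ind => // a b.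
by have := PM a b; rewrite tens_mul_pure mulr1 mul1r.
Qed.

Variables (C : comPzRingType) (p : {rmorphism A -> C}) (q : {rmorphism B -> C}).
Hypothesis pq : forall c, p (f c) = q (g c).

Lemma tens_alg_lift_inl a : tens_alg_lift pq (tens_inl f g a) = p a.
Proof. by rewrite [LHS]tens_alg_lift_pure rmorph1 mulr1. Qed.

Lemma tens_alg_lift_inr b : tens_alg_lift pq (tens_inr f g b) = q b.
Proof. by rewrite [LHS]tens_alg_lift_pure rmorph1 mul1r. Qed.

Lemma scale_inl_inr_pure (M : lmodType A) (N : lmodType B) a b m n :
  (tens_inl f g a * tens_inr f g b) *:
    (pure (m : restrict f M) (n : restrict g N) : tens_mod f g M N) =
  pure (a *: m : restrict f M) (b *: n : restrict g N).
Proof.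
rewrite tens_mul_pure mulr1 mul1r.
by rewrite -[LHS]/(tens_act _ _) tens_act_pure tens_act1_pure.
Qed.

End TensAlg.

Section Family.
Variables (k : fieldType) (R : comNzRingType) (f : {rmorphism k -> R}).
Variables (V : idomainType) (g : {rmorphism k -> V}) (t : V).
Hypothesis unif : t != 0 /\ bijective (fun c => to_quot t (g c : V^o)).

Local Notation T := (tens_alg f g).
Local Notation tau := (tens_inr f g t).

Definition base_expansion : {rmorphism V -> series R} :=
  series_map f \o expansion unif.

Lemma base_expansion_const c : base_expansion (g c) = series_const (f c).
Proof. by rewrite /= expansion_const series_map_const. Qed.

Lemma base_expansion_var : base_expansion t = series_var.
Proof. by rewrite /= expansion_var series_map_var. Qed.

Fact total_expansion_compat c : series_const (f c) = base_expansion (g c).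
Proof. by rewrite base_expansion_const. Qed.

(** The completion [R (x) V -> R[[t]]]. *)
Definition total_expansion : {rmorphism T -> series R} :=
  tens_alg_lift (p := series_const) (q := base_expansion) total_expansion_compat.

Lemma total_expansion_inl r : total_expansion (tens_inl f g r) = series_const r.
Proof. exact: tens_alg_lift_inl. Qed.

Lemma total_expansion_inr v : total_expansion (tens_inr f g v) = base_expansion v.
Proof. exact: tens_alg_lift_inr. Qed.

Variables (M : lmodType R) (lambda : {linear M -> R^o}).
Local Notation L := (loc_ring (base_expansion t)).
Local Notation gt := (loc_in t \o g).

Let into : {rmorphism series R -> L} := loc_in (base_expansion t).
Let locV : {rmorphism loc_ring t -> L} := loc_map base_expansion (s := t).

Fact laurent_compat c : (into \o series_const) (f c) = locV (gt c).
Proof. by rewrite [RHS]loc_mapE base_expansion_const. Qed.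

Let laurent : {rmorphism tens_alg f gt -> L} := tens_alg_lift laurent_compat.

Let locV_t : locV (loc_in t t) = into series_var.
Proof. by rewrite [LHS]loc_mapE -base_expansion_var. Qed.

Let laurent_inl r : laurent (tens_inl f gt r) = into (series_const r).
Proof. exact: tens_alg_lift_inl. Qed.

Let laurent_inr u : laurent (tens_inr f gt u) = locV u.
Proof. exact: tens_alg_lift_inr. Qed.

(** The map [M (x) V_t -> R((t))] induced by [lambda], where [R((t))] is the
    localization of [R[[t]]] at the image of [t]. *)
Definition laurent_coord (x : tens_mod f gt M (loc_ring t)^o) : L :=
  tens_lift (M := restrict f M) (N := restrict gt (loc_ring t)^o)
    (fun m u => into (series_const (lambda m)) * locV u) x.

Fact laurent_coord_balanced :
  balanced (fun (m : restrict f M) (u : restrict gt (loc_ring t)^o) =>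
    into (series_const (lambda m)) * locV u).
Proof.
split=> [m m' u|m u u'|c m u].
- by rewrite !raddfD mulrDl.
- by rewrite rmorphD mulrDr.
rewrite !restrictZ linearZ_LR -[gt c *: u]/(gt c * u) -[f c *: _]/(f c * _).
have e : into (series_const (f c)) = locV (gt c) := laurent_compat c.
by rewrite !rmorphM e mulrCA mulrA.
Qed.

Lemma laurent_coordD : {morph laurent_coord : x y / x + y}.
Proof. exact: (tens_liftD laurent_coord_balanced). Qed.

Lemma laurent_coord0 : laurent_coord 0 = 0.
Proof. exact: (tens_lift0 laurent_coord_balanced). Qed.

Lemma laurent_coord_pure m u :
  laurent_coord (pure (m : restrict f M) (u : restrict gt (loc_ring t)^o)) =
  into (series_const (lambda m)) * locV u.
Proof. exact: (tens_lift_pure laurent_coord_balanced). Qed.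

Lemma laurent_coordZ c x : laurent_coord (c *: x) = laurent c * laurent_coord x.
Proof.
elim/tens_alg_ind: c => [|c c' IHc IHc'|r u].
- by rewrite scale0r rmorph0 mul0r laurent_coord0.
- by rewrite scalerDl laurent_coordD rmorphD mulrDl IHc IHc'.
elim/(@tens_ind k): x => [|x x' IHx IHx'|m w].
- by rewrite scaler0 laurent_coord0 mulr0.
- by rewrite scalerDr !laurent_coordD mulrDr IHx IHx'.
rewrite scale_inl_inr_pure !laurent_coord_pure (rmorphM laurent) laurent_inl laurent_inr.
by rewrite linearZ_LR -[u *: w]/(u * w) -[r *: _]/(r * _) !rmorphM mulrACA.
Qed.

Variable Q : lmodType T.
Variable h : {linear restrict (loc_tens f g t) (loc_mod tau Q) ->
  tens_mod f gt M (loc_ring t)^o}.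

Let lattice_coord (q : Q) : L := laurent_coord (h (Defs.frac tau q 0)).

Let lattice_coordD : {morph lattice_coord : x y / x + y}.
Proof. by move=> x y; rewrite /lattice_coord fracD raddfD laurent_coordD. Qed.

Let loc_tens_inl r : loc_tens f g t (tens_inl f gt r) = loc_in tau (tens_inl f g r).
Proof. exact: tens_alg_lift_inl. Qed.

Let loc_tens_inr v :
  loc_tens f g t (tens_inr f gt (loc_in t v)) = loc_in tau (tens_inr f g v).
Proof. by rewrite /loc_tens tens_alg_lift_inr [LHS]loc_mapE. Qed.

Let h_frac c d q n : loc_tens f g t d = loc_in tau c ->
  laurent_coord (h (Defs.frac tau (c *: q) n)) =
  laurent d * laurent_coord (h (Defs.frac tau q n)).
Proof.
move=> dc; have -> : Defs.frac tau (c *: q) n =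
    d *: (Defs.frac tau q n : restrict (loc_tens f g t) (loc_mod tau Q)).
  transitivity (loc_tens f g t d *: Defs.frac tau q n); last by [].
  by rewrite dc [RHS]loc_actE.
by rewrite linearZ_LR laurent_coordZ.
Qed.

Let lattice_coordZ c q :
  lattice_coord (c *: q) = into (total_expansion c) * lattice_coord q.
Proof.
elim/tens_alg_ind: c => [|c c' IHc IHc'|r v].
- rewrite scale0r rmorph0 mul0r; apply: (addrI (lattice_coord 0)).
  by rewrite -lattice_coordD !addr0.
- by rewrite scalerDl lattice_coordD !rmorphD mulrDl IHc IHc'.
rewrite /lattice_coord (h_frac (d := tens_inl f gt r * tens_inr f gt (loc_in t v))).
  rewrite (rmorphM laurent) (rmorphM total_expansion) laurent_inl laurent_inr.
  rewrite total_expansion_inl total_expansion_inr.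
  by rewrite [locV _]loc_mapE (rmorphM into).
rewrite (rmorphM (loc_tens f g t)) (rmorphM (loc_in tau)).
by congr (_ * _); [apply: loc_tens_inl | apply: loc_tens_inr].
Qed.

Let into_inj : injective into.
Proof.
move=> p q /eq_frac[j]; rewrite base_expansion_var.
exact: series_varX_inj.
Qed.

Let var_into n p : exists p' : series R,
  into series_var ^+ n * fracr (base_expansion t) p n = into p'.
Proof.
exists p; rewrite -rmorphXn [LHS]loc_mulE add0n; apply/eq_frac; exists 0.
by rewrite base_expansion_var /= add0n expr0 scale1r.
Qed.

(** [Q] is a lattice in its generic fibre [M (x) V_t], which [lambda] maps to
    [R((t))].  Since [Q] is finitely generated, one power of [t] brings its whole
    image into [R[[t]]]; conversely every element of [M] is, up to a power of
    [t], in the image of [Q]. *)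
Lemma lattice_series_coord : fin_gen Q -> bijective h ->
  exists Phi : Q -> series R,
  [/\ {morph Phi : x y / x + y},
      forall c q, Phi (c *: q) = total_expansion c * Phi q
    & forall m, exists q n, Phi q = series_var ^+ n * series_const (lambda m)].
Proof.
move=> [s [e eP]] [h' hK h'K].
have denom i : {p & {n | lattice_coord (e i) = fracr (base_expansion t) p n}}.
  exact: fracrP.
pose N := (\sum_i sval (projT2 (denom i)))%N.
have clear q : exists p, into series_var ^+ N * lattice_coord q = into p.
  have [c ->] := eP q; rewrite (big_morph _ lattice_coordD (id1 := 0)); last first.
    by rewrite /lattice_coord frac0 raddf0 laurent_coord0.
  rewrite mulr_sumr; elim/big_rec: _ => [|i x _ [p ->]]; first by exists 0; rewrite rmorph0.
  rewrite lattice_coordZ mulrCA.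
  (* The exponent N is the sum of those needed by the generators, so it
     exceeds each of them. *)
  have [p' e'] : exists p', into series_var ^+ N * lattice_coord (e i) = into p'.
    rewrite /N (bigD1 i) //= addnC exprD -mulrA; case: (denom i) => p' [n /= ->].
    have [p'' ->] := var_into n p'.
    by rewrite -!rmorphXn -rmorphM; eexists.
  by rewrite e' -rmorphM -rmorphD; eexists.
exists (fun q => sval (cid (clear q))).
split=> [x y|c q|m].
- apply: into_inj; rewrite rmorphD -!(svalP (cid (clear _))).
  by rewrite lattice_coordD mulrDr.
- apply: into_inj; rewrite rmorphM -!(svalP (cid (clear _))).
  by rewrite lattice_coordZ mulrCA.
pose w : tens_mod f gt M (loc_ring t)^o :=
  pure (m : restrict f M) (1 : restrict gt (loc_ring t)^o).
have [q [n hw]] := fracP (h' w); exists q, (n + N)%N.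
apply: into_inj; rewrite -(svalP (cid (clear _))).
have lift_n : lattice_coord q = into series_var ^+ n * laurent_coord w.
  rewrite -(h'K w) hw /lattice_coord -(frac_scale tau n) addn0.
  rewrite (h_frac (d := tens_inr f gt (loc_in t (t ^+ n)))) ?loc_tens_inr ?rmorphXn //.
  by rewrite laurent_inr locV_t.
rewrite lift_n laurent_coord_pure rmorph1 mulr1 rmorphM rmorphXn exprD.
by rewrite mulrCA mulrA.
Qed.
End Family.

(** * Lifting relations from the special fibre *)

Section Lifting.
Variables (R T : comPzRingType) (iota : {rmorphism R -> T}) (t : T).
Variables (Q : lmodType T) (N : lmodType R) (pi : {additive Q -> N}).
Hypothesis piZ : forall r q, pi (iota r *: q) = r *: pi q.
Hypothesis pi_surj : forall v, exists q, pi q = v.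
Hypothesis pi_ker : forall q, pi q = 0 <-> exists u, q = t *: u.
Hypothesis t_reg : forall q : Q, t *: q = 0 -> q = 0.

Lemma scaleCA (c d : T) (q : Q) : c *: (d *: q) = d *: (c *: q).
Proof. by rewrite !scalerA mulrC. Qed.

Lemma t_inj (q q' : Q) : t *: q = t *: q' -> q = q'.
Proof.
by move=> e; apply/eqP; rewrite -subr_eq0; apply/eqP/t_reg; rewrite scalerBr e subrr.
Qed.

Lemma tX_reg n (q : Q) : t ^+ n *: q = 0 -> q = 0.
Proof.
elim: n => [|n IHn]; first by rewrite scale1r.
by rewrite exprS -scalerA => /t_reg/IHn.
Qed.

Lemma pi_eq q q' : pi q = pi q' -> exists u, q = q' + t *: u.
Proof.
move=> e; have [u eu] : exists u, q - q' = t *: u.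
  by apply/pi_ker; rewrite raddfB e subrr.
by exists u; rewrite -eu addrC subrK.
Qed.

(** If [y q = t ^ (n + 1) u], then [x] annihilates [u], so that [u = y v] modulo
    [t] and [q - t ^ (n + 1) v] is a better lift of [e]. *)
Lemma lift_annihilated (x y : R) (e : N) n :
  x * y = 0 -> (forall v : N, x *: v = 0 -> exists w, v = y *: w) ->
  y *: e = 0 -> exists q u, pi q = e /\ iota y *: q = t ^+ n.+1 *: u.
Proof.
move=> xy0 annx ye0; elim: n => [|n [q [u [piq yq]]]].
- have [q piq] := pi_surj e; have [u eu] : exists u, iota y *: q = t *: u.
    by apply/pi_ker; rewrite piZ piq.
  by exists q, u.
have xu0 : iota x *: u = 0.
  apply: (@tX_reg n.+1); rewrite scalerA mulrC -scalerA -yq scalerA -rmorphM.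
  by rewrite xy0 rmorph0 scale0r.
have [w ew] : exists w, pi u = y *: w by apply: annx; rewrite -piZ xu0 raddf0.
have [v piv] := pi_surj w; have [|u' eu] := @pi_eq u (iota y *: v).
  by rewrite piZ piv.
exists (q - t ^+ n.+1 *: v), u'; split.
  rewrite raddfB piq; have -> : pi (t ^+ n.+1 *: v) = 0; last by rewrite subr0.
  by apply/pi_ker; exists (t ^+ n *: v); rewrite scalerA -exprS.
rewrite scalerBr yq eu scalerDr !scalerA mulrC addrAC subrr add0r.
by rewrite -exprSr.
Qed.

(** The description of the annihilator of [y] in the special fibre persists
    modulo [t ^ n]: subtracting a multiple of [e] makes [q] divisible by [t], and
    the quotient is again annihilated by [y], modulo [t ^ (n - 1)]. *)
Lemma approx_multiple (y : R) (e : Q) n :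
  (forall v, y *: v = 0 -> exists r, v = r *: pi e) ->
  (exists u, iota y *: e = t ^+ n *: u) ->
  forall q, (exists u, iota y *: q = t ^+ n *: u) ->
  exists c u, q = c *: e + t ^+ n *: u.
Proof.
move=> anny; elim: n => [|n IHn] [u ye] q [v yq].
  by exists 0, q; rewrite scale0r add0r scale1r.
have [r er] : exists r, pi q = r *: pi e.
  apply: anny; rewrite -piZ; apply/pi_ker.
  by exists (t ^+ n *: v); rewrite scalerA -exprS.
have [w ew] := @pi_eq q (iota r *: e) (etrans er (esym (piZ r e))).
have [||c [w' ew']] := IHn _ w.
- by exists (t *: u); rewrite scalerA -exprSr.
- exists (v - iota r *: u); apply: t_inj.
  have tw : t *: w = q - iota r *: e by rewrite ew addrAC subrr add0r.
  rewrite scaleCA tw [LHS]scalerBr yq [X in _ - X = _]scaleCA ye.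
  by rewrite [RHS]scalerA -exprS [RHS]scalerBr scaleCA.
exists (iota r + t * c), w'.
by rewrite ew ew' scalerDr scalerDl !scalerA -exprS addrA.
Qed.

(** Nakayama's lemma, modulo [t ^ n]. *)
Lemma approx_span (e1 e2 : Q) n :
  (forall v, exists r1 r2, v = r1 *: pi e1 + r2 *: pi e2) ->
  forall q, exists c1 c2 u, q = c1 *: e1 + c2 *: e2 + t ^+ n *: u.
Proof.
move=> gen; elim: n => [|n IHn] q.
  by exists 0, 0, q; rewrite !scale0r !add0r scale1r.
have [r1 [r2 er]] := gen (pi q).
have [|u eu] := @pi_eq q (iota r1 *: e1 + iota r2 *: e2).
  by rewrite raddfD /= !piZ.
have [c1 [c2 [v ev]]] := IHn u.
exists (iota r1 + t * c1), (iota r2 + t * c2), v.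
rewrite eu ev !scalerDr !scalerDl !scalerA -exprS.
by rewrite [LHS]addrA; congr (_ + _); rewrite addrACA.
Qed.

End Lifting.

(** * The divisibility forced by a degeneration *)

Section Core.
Variables (R C : comNzRingType) (x y z : R) (rho : {rmorphism R -> C}).
Hypotheses (xy0 : x * y = 0) (rhox : rho x = 0) (rhoy : rho y = 0).
Hypothesis ann_x : forall r, x * r = 0 -> exists s, r = y * s.
Hypothesis ann_y : forall r, y * r = 0 -> exists s, r = x * s.

Variables (T : comPzRingType) (iota : {rmorphism R -> T}) (t : T).
Variables (Q : lmodType T) (N : lmodType R) (pi : {additive Q -> N}).
Hypothesis piZ : forall r q, pi (iota r *: q) = r *: pi q.
Hypothesis pi_surj : forall v, exists q, pi q = v.
Hypothesis pi_ker : forall q, pi q = 0 <-> exists u, q = t *: u.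
Hypothesis t_reg : forall q : Q, t *: q = 0 -> q = 0.

Variables (sigma : {rmorphism T -> series R}) (Phi : Q -> series R).
Hypothesis sigma_iota : forall r, sigma (iota r) = series_const r.
Hypothesis sigma_t : sigma t = series_var.
Hypothesis PhiD : {morph Phi : u v / u + v}.
Hypothesis PhiZ : forall c q, Phi (c *: q) = sigma c * Phi q.

Variables (e1 e2 : N) (b : nat).
Hypothesis gen : forall v, exists r1 r2, v = r1 *: e1 + r2 *: e2.
Hypotheses (ye1 : y *: e1 = 0) (xe2 : x *: e2 = z ^+ b *: e1).
Hypothesis annN_y : forall v : N, y *: v = 0 -> exists r, v = r *: e1.
Hypothesis annN_x : forall v : N, x *: v = 0 -> exists w, v = y *: w.
Hypothesis z_reg : injective ( *%R (rho z ^+ b)).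

(** The generic fibre enters through the element [eps] alone: [x eps] is a
    multiple of the lift of [e1] modulo [t ^ n], and applying [Phi] compares the
    multiplier, a combination of [x] and of a deformation of [z ^ b], with
    [t ^ m z ^ a]. *)
Lemma dvd_of_family (eps : Q) m a :
  Phi eps = series_var ^+ m * series_const (z ^+ a) ->
  exists c, rho z ^+ a = rho z ^+ b * c.
Proof.
move=> Phi_eps; pose n := m.+1.
have [E1 [u1 [piE1 yE1]]] := lift_annihilated piZ pi_surj pi_ker t_reg n xy0 annN_x ye1.
have [E2 piE2] := pi_surj e2.
have [|v ev] := pi_eq pi_ker (q := iota x *: E2) (q' := iota (z ^+ b) *: E1).
  by rewrite !piZ piE1 piE2.
(* Multiplying x E2 - z ^ b E1 = t v by y kills the first term, because x y = 0,
   and makes the second divisible by t ^ (n + 1). *)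
have [c [v' ev']] : exists c v', v = c *: E1 + t ^+ n *: v'.
  apply: (approx_multiple piZ pi_ker t_reg (y := y)).
  - by rewrite piE1.
  - by exists (t *: u1); rewrite scalerA -exprSr.
  exists (- (iota (z ^+ b) *: u1)); apply: (t_inj t_reg).
  have tv : t *: v = iota x *: E2 - iota (z ^+ b) *: E1 by rewrite ev addrAC subrr add0r.
  rewrite scaleCA tv [LHS]scalerBr [X in X - _ = _]scalerA -rmorphM mulrC xy0.
  rewrite rmorph0 scale0r sub0r [X in - X = _]scaleCA yE1.
  by rewrite [RHS]scalerA -exprS scalerN scaleCA.
have [|c1 [c2 [w ew]]] := approx_span piZ pi_ker (e1 := E1) (e2 := E2) n _ eps.
  by rewrite piE1 piE2.
(* The multiplier in x E2 = beta E1 modulo t ^ n. *)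
pose beta := iota (z ^+ b) + t * c.
have [w' ew'] : exists w', iota x *: eps = (iota x * c1 + c2 * beta) *: E1 + t ^+ n *: w'.
  exists (c2 *: (t *: v') + iota x *: w).
  rewrite ew !scalerDr !scalerA [iota x * c2]mulrC -[(c2 * iota x) *: E2]scalerA ev ev'.
  rewrite !scalerDr !scalerA /beta mulrDr !scalerDl.
  rewrite [t ^+ n * iota x]mulrC [t ^+ n * _]mulrC !mulrA -!addrA.
  by rewrite (mulrAC c2 t (t ^+ n)).
have [d [p ed]] : exists d p,
    Phi E1 = series_const x * d + series_var ^+ n * p.
  apply: series_split => i lin; apply: ann_y.
  rewrite -coef_constM -sigma_iota -PhiZ yE1 PhiZ rmorphXn /= sigma_t coef_varXM.
  by rewrite ltnW.
(* The two expressions of x Phi(eps) agree modulo t ^ n, so x annihilates s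
   there and s vanishes on the axis x = y = 0. *)
pose s := series_var ^+ m * series_const (z ^+ a) - sigma (iota x * c1 + c2 * beta) * d.
have xs : exists p', series_const x * s = series_var ^+ n * p'.
  eexists; rewrite /s mulrBr -Phi_eps -sigma_iota -PhiZ ew' PhiD !PhiZ ed.
  rewrite rmorphXn /= sigma_t mulrDr sigma_iota [series_const x * (_ * _)]mulrCA.
  rewrite addrAC [X in X + _]addrAC subrr add0r mulrCA -mulrDr; reflexivity.
have s0 i : (i < n)%N -> rho (s i) = 0.
  move=> lin; have [p' e'] := xs; have [r ->] : exists r, s i = y * r.
    by apply: ann_x; rewrite -coef_constM e' coef_varXM lin.
  by rewrite rmorphM rhoy mul0r.
exists (series_map rho (sigma c2 * d) m).
apply: (series_leading_dvd (q := series_map rho (sigma c))) => // i lim.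
have := s0 i lim; rewrite -[rho _]/(series_map rho s i) /s.
rewrite rmorphB /= coef_seriesD coef_seriesN => /eqP; rewrite subr_eq0 => /eqP.
rewrite !rmorphM rmorphXn /= series_map_var series_map_const rmorphXn /= => ->.
rewrite /beta !rmorphD !rmorphM !rmorphD !rmorphM /= !sigma_iota sigma_t.
rewrite !series_map_const series_map_var rhox rmorph0 mul0r add0r rmorphXn.
by rewrite mulrAC.
Qed.

End Core.

(** Multiplication by [t] on [V] stays injective after tensoring with [P]. *)
Lemma flat_regular (V : idomainType) (t : V) (P : lmodType V) (p : P) :
  flat P -> t != 0 -> t *: p = 0 -> p = 0.
Proof.
move=> flatP t0 tp0; pose h : {linear V^o -> V^o} := GRing.scale t.
have h_inj : injective h by move=> a b; apply: mulfI.
have [pDl pDr pZ] := pure_balanced V^o P.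
have hB : balanced (fun a q => pure (h a) q : tensor V^o P).
  split=> [a a' q|a q q'|c a q]; rewrite ?raddfD ?pDl ?pDr //.
  by rewrite linearZ pZ.
have sB : balanced (fun (a : V^o) (q : P) => a *: q).
  split=> [a a' q|a q q'|c a q]; rewrite ?scalerDl ?scalerDr //.
  by rewrite scalerA mulrC.
have pure0 (a : V^o) : pure a (0 : P) = 0.
  by apply: (addrI (pure a 0)); rewrite -pDr !addr0.
have : pure (1 : V^o) p = 0.
  apply: (flatP _ _ h h_inj); rewrite /tens_map (tens_lift0 hB) (tens_lift_pure hB).
  by rewrite -[h 1]/(t *: (1 : V^o)) pZ tp0 pure0.
move/(congr1 (tens_lift (fun (a : V^o) (q : P) => a *: q))).
by rewrite (tens_lift_pure sB) (tens_lift0 sB) scale1r.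
Qed.

Section QuotLinear.
Variables (T : comPzRingType) (s : T) (Q : lmodType T).

Fact to_quot_zmod : zmod_morphism (@to_quot T s Q).
Proof. by move=> x y; apply: (addIr (to_quot s y)); rewrite -to_quotD !subrK. Qed.

HB.instance Definition _ :=
  GRing.isZmodMorphism.Build Q (quot_mod s Q) (@to_quot T s Q) to_quot_zmod.

Lemma to_quotZ c q : to_quot s (c *: q : Q) = c *: to_quot s q.
Proof. exact/esym/quot_scaleE. Qed.

Lemma to_quot_eq0 q : to_quot s (q : Q) = 0 <-> exists u, q = s *: u.
Proof. by rewrite -(raddf0 (@to_quot T s Q)) eq_to_quot subr0. Qed.
End QuotLinear.

Section Degeneration.
Variables (k : fieldType) (R C : comNzRingType) (f : {rmorphism k -> R}).
Variables (x y z : R) (rho : {rmorphism R -> C}).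
Hypotheses (xy0 : x * y = 0) (rhox : rho x = 0) (rhoy : rho y = 0).
Hypothesis ann_x : forall r, x * r = 0 -> exists s, r = y * s.
Hypothesis ann_y : forall r, y * r = 0 -> exists s, r = x * s.

Variables (M N : lmodType R) (lambda : {linear M -> R^o}) (m0 : M) (a b : nat).
Variables (e1 e2 : N).
Hypothesis lambda_m0 : lambda m0 = z ^+ a.
Hypothesis gen : forall v, exists r1 r2, v = r1 *: e1 + r2 *: e2.
Hypotheses (ye1 : y *: e1 = 0) (xe2 : x *: e2 = z ^+ b *: e1).
Hypothesis annN_y : forall v : N, y *: v = 0 -> exists r, v = r *: e1.
Hypothesis annN_x : forall v : N, x *: v = 0 -> exists w, v = y *: w.
Hypothesis z_reg : injective ( *%R (rho z ^+ b)).

Lemma degenerates_dvd : degenerates f M N -> exists c, rho z ^+ a = rho z ^+ b * c.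
Proof.
move=> [V [g [t [[_ t0 _ _] res_bij [Q [fgQ flatQ [h0 h0_bij] [h h_bij]]]]]]].
pose unif := conj t0 res_bij; pose tau := tens_inr f g t.
have t_reg (q : Q) : tau *: q = 0 -> q = 0 by move=> tq0; apply: flat_regular flatQ t0 tq0.
pose pi : {additive Q -> N} := h0 \o (@to_quot _ tau Q).
have piZ r q : pi (tens_inl f g r *: q) = r *: pi q.
  by rewrite /= to_quotZ -linearZ.
have pi_surj v : exists q, pi q = v.
  have [h0' _ h0'K] := h0_bij; exists (repr (h0' v)).
  by rewrite /= to_quotK h0'K.
have pi_ker q : pi q = 0 <-> exists u, q = tau *: u.
  rewrite -to_quot_eq0; split=> [|/= ->]; last exact: (raddf0 h0).
  by rewrite -(raddf0 h0) => /(bij_inj h0_bij).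
have [Phi [PhiD PhiZ Phi_lambda]] := lattice_series_coord unif lambda fgQ h_bij.
have [eps [m Phi_eps]] := Phi_lambda m0; rewrite lambda_m0 in Phi_eps.
apply: (dvd_of_family xy0 rhox rhoy ann_x ann_y piZ pi_surj pi_ker t_reg
  (sigma := total_expansion f unif) _ _ PhiD PhiZ gen ye1 xe2 annN_y annN_x z_reg Phi_eps).
- exact: total_expansion_inl.
- by rewrite total_expansion_inr base_expansion_var.
Qed.

End Degeneration.

Lemma mem_ideal (A : comPzRingType) (s : seq A) i :
  (i < size s)%N -> (s`_i : A^o) \in ideal s.
Proof.
move=> lis; apply/asboolP; exists (fun j => (j == Ordinal lis)%:R).
rewrite (bigD1 (Ordinal lis)) //= eqxx mul1r big1 ?addr0 // => j /negPf->.
by rewrite mul0r.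
Qed.

(** * Degenerations to an ideal generated by [x] and a power of [z] *)

Section TwoGenerators.
Variables (k : fieldType) (R C : comNzRingType) (f : {rmorphism k -> R}).
Variables (x y z : R) (rho : {rmorphism R -> C}) (a b : nat).
Hypotheses (xy0 : x * y = 0) (rhox : rho x = 0) (rhoy : rho y = 0).
Hypothesis ann_x : forall r, x * r = 0 -> exists s, r = y * s.
Hypothesis ann_y : forall r, y * r = 0 -> exists s, r = x * s.
Hypothesis cap_xy : forall r s, x * r = y * s -> x * r = 0.
Hypothesis ker_rho : forall r, rho r = 0 -> exists u v, r = x * u + y * v.
Hypothesis z_reg : injective ( *%R (rho z ^+ b)).

Local Notation N := (ideal_mod [:: x; z ^+ b]).

(** The one delicate point is that every [v] in [(x, z ^ b)] killed by [x] lies in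
    [y (x, z ^ b)]: writing [v = r1 x + r2 z ^ b], as [v] is a multiple of [y], [r2]
    vanishes on the axis [x = y = 0]; so [v] differs from a multiple of [y z ^ b]
    by an element of both [x R] and [y R], hence by zero. *)
Lemma degenerates_ideal_dvd (s : seq R) : (z ^+ a : R^o) \in ideal s ->
  degenerates f (ideal_mod s) N -> exists c, rho z ^+ a = rho z ^+ b * c.
Proof.
move=> za_s.
pose e1 : N := IdealMod (mem_ideal (isT : (0 < size [:: x; z ^+ b])%N)).
pose e2 : N := IdealMod (mem_ideal (isT : (1 < size [:: x; z ^+ b])%N)).
have valZ r (v : N) : ideal_val (r *: v) = r * ideal_val v by [].
have gen (v : N) : exists r1 r2, v = r1 *: e1 + r2 *: e2.
  have /asboolP[c vE] := valP v; exists (c ord0), (c ord_max); apply: val_inj.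
  rewrite [LHS]vE !big_ord_recl big_ord0 addr0 /=.
  by congr (_ + c _ * _); apply: val_inj.
apply: (degenerates_dvd xy0 rhox rhoy ann_x ann_y
  (lambda := \val) (m0 := IdealMod za_s) (e1 := e1) (e2 := e2)) => //.
- by apply: val_inj; exact: (etrans (mulrC y x) xy0).
- by apply: val_inj; apply: mulrC.
- move=> v yv0; have [r vr] : exists r, ideal_val v = x * r.
    by apply: ann_y; rewrite -valZ yv0.
  by exists r; apply: val_inj; rewrite [LHS]vr; apply: mulrC.
move=> v xv0; have [r1 [r2 ev]] := gen v.
have valv : ideal_val v = r1 * x + r2 * z ^+ b by rewrite ev.
have [s' vs] : exists s', ideal_val v = y * s'.
  by apply: ann_x; rewrite -valZ xv0.
have [u [w r2E]] : exists u w, r2 = x * u + y * w.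
  apply: ker_rho; apply: z_reg; rewrite mulr0 mulrC -rmorphXn -rmorphM.
  have <- : y * s' - r1 * x = r2 * z ^+ b by rewrite -vs valv addrAC subrr add0r.
  by rewrite rmorphB !rmorphM rhox rhoy mulr0 mul0r subr0.
have vE : ideal_val v = x * (r1 + u * z ^+ b) + y * (w * z ^+ b).
  by rewrite valv r2E mulrDl mulrDr addrA !mulrA [r1 * x]mulrC.
exists (w *: e2); apply: val_inj; rewrite [LHS]vE (@cap_xy _ (s' - w * z ^+ b)).
  exact: add0r.
by rewrite mulrBr -vs vE addrK.
Qed.

End TwoGenerators.

(** * The ring k[[x, y, z]] / (xy) *)

Section PowerSeries.
Variable k : comNzRingType.
Local Notation P := (pseries3 k).
Implicit Types p q : P.

Lemma coef_psXM p i j l : (psX k * p) i j l = if i is i'.+1 then p i' j l else 0.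
Proof.
rewrite -[LHS]/(ps_mul _ _ _ _ _) /ps_mul; case: i => [|i].
  by rewrite big_ord1 big1 // => b _; rewrite big1 // => c _; rewrite mul0r.
rewrite big_ord_recl big1 ?add0r; last first.
  by move=> b _; rewrite big1 // => c _; rewrite mul0r.
rewrite big_ord_recl [X in _ + X]big1 ?addr0; last first.
  by move=> a _; rewrite big1 // => b _; rewrite big1 // => c _; rewrite mul0r.
do 2!(rewrite big_ord_recl [X in _ + X]big1 ?addr0; last first;
  [by move=> b _; do ?[rewrite big1 // => ? _]; rewrite mul0r|]).
by rewrite mul1r !subn0 subSS subn0.
Qed.

Lemma coef_psYM p i j l : (psY k * p) i j l = if j is j'.+1 then p i j' l else 0.
Proof.
rewrite -[LHS]/(ps_mul _ _ _ _ _) /ps_mul big_ord_recl [X in _ + X]big1 ?addr0; last first.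
  by move=> a _; rewrite big1 // => b _; rewrite big1 // => c _; rewrite mul0r.
case: j => [|j]; first by rewrite big_ord1 big1 // => c _; rewrite mul0r.
rewrite big_ord_recl big1 ?add0r; last first.
  by move=> c _; rewrite mul0r.
do 2!(rewrite big_ord_recl [X in _ + X]big1 ?addr0; last first;
  [by move=> b _; do ?[rewrite big1 // => ? _]; rewrite mul0r|]).
by rewrite mul1r !subn0 subSS subn0.
Qed.

Lemma Rxy_surj (r : Rxy k) : exists p, r = proj_xy p.
Proof. by exists (repr r); rewrite /proj_xy reprK. Qed.

Lemma eq_proj_xy p q : proj_xy p = proj_xy q <-> exists c, p - q = psX k * psY k * c.
Proof.
split=> [/eqP|[c e]].
  rewrite /proj_xy -Quotient.idealrBE => /asboolP[c ->]; exists (c ord0).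
  by rewrite big_ord1 mulrC.
apply/eqP; rewrite /proj_xy -Quotient.idealrBE; apply/asboolP; exists (fun=> c).
by rewrite big_ord1 /= mulrC.
Qed.

Lemma Rxy_xy0 : Rxy_x k * Rxy_y k = 0.
Proof.
rewrite /Rxy_x /Rxy_y -rmorphM -(rmorph0 (@proj_xy k)); apply/eq_proj_xy.
by exists 1; rewrite subr0 mulr1.
Qed.

Lemma psX_inj : injective ( *%R (psX k)).
Proof.
move=> p q pq; apply: ps_ext => i j l.
by have := congr1 (fun h : P => h i.+1 j l) pq; rewrite !coef_psXM.
Qed.

Lemma psY_inj : injective ( *%R (psY k)).
Proof.
move=> p q pq; apply: ps_ext => i j l.
by have := congr1 (fun h : P => h i j.+1 l) pq; rewrite !coef_psYM.
Qed.

Lemma Rxy_ann_x r : Rxy_x k * r = 0 -> exists s, r = Rxy_y k * s.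
Proof.
have [p ->] := Rxy_surj r; rewrite -rmorphM -(rmorph0 (@proj_xy k)).
case/eq_proj_xy=> c; rewrite subr0 -mulrA => /psX_inj->.
by exists (proj_xy c); rewrite rmorphM.
Qed.

Lemma Rxy_ann_y r : Rxy_y k * r = 0 -> exists s, r = Rxy_x k * s.
Proof.
have [p ->] := Rxy_surj r; rewrite -rmorphM -(rmorph0 (@proj_xy k)).
case/eq_proj_xy=> c; rewrite subr0 [psX k * _]mulrC -mulrA => /psY_inj->.
by exists (proj_xy c); rewrite rmorphM.
Qed.

(** If [x p = y q] modulo [x y], then [x d = y q] with [d = p] modulo [y]; the
    terms of [d] free of [y] vanish, hence [y] divides [p]. *)
Lemma Rxy_cap r s : Rxy_x k * r = Rxy_y k * s -> Rxy_x k * r = 0.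
Proof.
have [p ->] := Rxy_surj r; have [q ->] := Rxy_surj s; rewrite -!rmorphM.
case/eq_proj_xy=> c e; pose d := p - psY k * c.
have ed : psX k * d = psY k * q.
  by rewrite mulrBr mulrA -e opprB addrC subrK.
pose d' : P := fun i j l => d i j.+1 l.
have -> : p = psY k * (d' + c).
  rewrite mulrDr; have <- : d = psY k * d'; last by rewrite subrK.
  apply: ps_ext => i [|j] l; rewrite coef_psYM //.
  have := congr1 (fun h : P => h i.+1 0%N l) ed.
  by rewrite coef_psXM coef_psYM.
by rewrite mulrA !rmorphM /= Rxy_xy0 mul0r.
Qed.

(** Restriction to the axis [x = y = 0]. *)
Definition z_axis p : series k := fun l => p 0%N 0%N l.

Fact z_axis_zmod : zmod_morphism z_axis. Proof. by []. Qed.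
Fact z_axis_monoid : monoid_morphism z_axis.
Proof.
split=> [|p q]; apply: funext => l; first by case: l.
by rewrite /z_axis -[LHS]/(ps_mul _ _ _ _ _) /ps_mul !big_ord1.
Qed.
HB.instance Definition _ :=
  GRing.isZmodMorphism.Build P (series k) z_axis z_axis_zmod.
HB.instance Definition _ :=
  GRing.isMonoidMorphism.Build P (series k) z_axis z_axis_monoid.

Lemma z_axis_x : z_axis (psX k) = 0.
Proof. by apply: funext => -[|l]. Qed.
Lemma z_axis_y : z_axis (psY k) = 0.
Proof. by apply: funext => -[|l]. Qed.
Lemma z_axis_z : z_axis (psZ k) = series_var.
Proof. by apply: funext. Qed.

Definition Rxy_z_axis (r : Rxy k) : series k := z_axis (repr r).

Lemma Rxy_z_axisE p : Rxy_z_axis (proj_xy p) = z_axis p.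
Proof.
have /eq_proj_xy[c e] : proj_xy (repr (proj_xy p)) = proj_xy p.
  by rewrite {1}/proj_xy reprK.
apply/eqP; rewrite -subr_eq0 -rmorphB e !rmorphM /= z_axis_x.
by rewrite !mul0r.
Qed.

Fact Rxy_z_axis_zmod : zmod_morphism Rxy_z_axis.
Proof.
move=> r s; have [p ->] := Rxy_surj r; have [q ->] := Rxy_surj s.
by rewrite -rmorphB !Rxy_z_axisE rmorphB.
Qed.
Fact Rxy_z_axis_monoid : monoid_morphism Rxy_z_axis.
Proof.
split=> [|r s].
  by rewrite -(rmorph1 (@proj_xy k)) Rxy_z_axisE rmorph1.
have [p ->] := Rxy_surj r; have [q ->] := Rxy_surj s.
by rewrite -rmorphM !Rxy_z_axisE rmorphM.
Qed.
HB.instance Definition _ :=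
  GRing.isZmodMorphism.Build (Rxy k) (series k) Rxy_z_axis Rxy_z_axis_zmod.
HB.instance Definition _ :=
  GRing.isMonoidMorphism.Build (Rxy k) (series k) Rxy_z_axis Rxy_z_axis_monoid.

Lemma Rxy_z_axis_ker r : Rxy_z_axis r = 0 ->
  exists u v, r = Rxy_x k * u + Rxy_y k * v.
Proof.
have [p ->] := Rxy_surj r; rewrite Rxy_z_axisE => p0.
pose u : P := fun i j l => p i.+1 j l.
pose v : P := fun i j l => if i is 0%N then p 0%N j.+1 l else 0.
exists (proj_xy u), (proj_xy v); rewrite -!rmorphM -rmorphD; congr proj_xy.
apply: ps_ext => i j l.
rewrite -[RHS]/((psX k * u) i j l + (psY k * v) i j l) coef_psXM coef_psYM.
case: i => [|i]; last by case: j => [|j]; rewrite addr0.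
case: j => [|j]; rewrite add0r //.
by move/(congr1 (fun h : series k => h l)): p0; rewrite coef_series0.
Qed.

End PowerSeries.

Theorem theorem3p2 (k : closedFieldType) (char_k : 2%N \notin [pchar k])
    (a b : nat) (ltab : (a < b)%N) :
  [/\ ~ degenerates (Rxy_in k) (xz_ideal k a) (xz_ideal k b),
      ~ degenerates (Rxy_in k) (xz_ideal k a) (yz_ideal k b),
      ~ degenerates (Rxy_in k) (yz_ideal k a) (xz_ideal k b)
    & ~ degenerates (Rxy_in k) (yz_ideal k a) (yz_ideal k b)].
Proof.
have rho_x : Rxy_z_axis (Rxy_x k) = 0 by rewrite Rxy_z_axisE z_axis_x.
have rho_y : Rxy_z_axis (Rxy_y k) = 0 by rewrite Rxy_z_axisE z_axis_y.
have rho_z : Rxy_z_axis (Rxy_z k) = series_var by rewrite Rxy_z_axisE z_axis_z.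
have z_reg : injective ( *%R (Rxy_z_axis (Rxy_z k) ^+ b)).
  by rewrite rho_z; apply: series_varX_inj.
have no_dvd : ~ exists c, Rxy_z_axis (Rxy_z k) ^+ a = Rxy_z_axis (Rxy_z k) ^+ b * c.
  rewrite rho_z => /series_var_dvdP/(_ a ltab).
  by rewrite -[_ ^+ _]mulr1 coef_varXM ltnn subnn => /eqP; rewrite oner_eq0.
have za_mem (r : Rxy k) : (Rxy_z k ^+ a : (Rxy k)^o) \in ideal [:: r; Rxy_z k ^+ a].
  exact: (mem_ideal (isT : (1 < size [:: r; Rxy_z k ^+ a])%N)).
have to_x := degenerates_ideal_dvd (Rxy_xy0 k) rho_x rho_y (@Rxy_ann_x k)
  (@Rxy_ann_y k) (@Rxy_cap k) (@Rxy_z_axis_ker k) z_reg (za_mem _).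
have cap_yx (r s : Rxy k) : Rxy_y k * r = Rxy_x k * s -> Rxy_y k * r = 0.
  by move=> e; rewrite e; apply/Rxy_cap/esym/e.
have ker_yx (r : Rxy k) : Rxy_z_axis r = 0 ->
    exists u v, r = Rxy_y k * u + Rxy_x k * v.
  by case/Rxy_z_axis_ker=> u [v ->]; exists v, u; rewrite addrC.
have to_y := degenerates_ideal_dvd (etrans (mulrC _ _) (Rxy_xy0 k)) rho_y rho_x
  (@Rxy_ann_y k) (@Rxy_ann_x k) cap_yx ker_yx z_reg (za_mem _).
by split=> [/to_x|/to_y|/to_x|/to_y] /no_dvd.
Qed.
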